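(* Let $\mathcal{X}$ be a measurable space, let $k:\mathcal{X}\times\mathcal{X}\to\mathbb{R}$ be a measurable reproducing kernel with $|k(x,y)|\le 1$ for all $x,y\in\mathcal{X}$, and let $\{\mathbb{P}_\theta:\theta\in\Theta\}$ be a family of Borel probability measures on $\mathcal{X}$. Let $\mathbb{P}^*_0$ be a Borel probability measure on $\mathcal{X}$, let $n\ge 1$, and let $x_1,\dots,x_n$ be i.i.d. with law $\mathbb{P}^*_0$. Fix $\alpha>0$, an integer $T\ge 1$ and a Borel probability measure $\mathbb{F}$ on $\mathcal{X}$, and let $\nu_n$ be the approximate posterior defined in the context. Then \[ \mathbb{E}_{x_{1:n}\overset{\text{iid}}{\sim}\mathbb{P}^*_0}\Big[\mathbb{E}_{\mathbb{P}\sim\nu_n}\big[\mathrm{MMD}(\mathbb{P}^*_0,\mathbb{P}_{\theta^*(\mathbb{P})})\big]\Big] \le \inf_{\theta\in\Theta}\mathrm{MMD}(\mathbb{P}^*_0,\mathbb{P}_\theta)+\frac{2}{\sqrt{n}}+2\sqrt{\frac{2(n-1)+\alpha(\alpha+1)}{(\alpha+n)(n+\alpha+1)}}+2\sqrt{\frac{\alpha(1+\alpha)}{(\alpha+n)(\alpha+n+1)}}. \]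
   Context: For a Borel probability measure $\mathbb{P}$ on $\mathcal{X}$, its kernel mean embedding is $\mu_{\mathbb{P}}=\int k(x,\cdot)\,\mathbb{P}(dx)$, an element of the reproducing kernel Hilbert space $\mathcal{H}_k$ of $k$, and the maximum mean discrepancy is $\mathrm{MMD}(\mathbb{P},\mathbb{Q})=\|\mu_{\mathbb{P}}-\mu_{\mathbb{Q}}\|_{\mathcal{H}_k}$. For a probability measure $\mathbb{P}$, $\theta^*(\mathbb{P})$ denotes a minimiser $\theta^*(\mathbb{P})\in\arg\inf_{\theta\in\Theta}\mathrm{MMD}^2(\mathbb{P},\mathbb{P}_\theta)$ (assumed to exist and to be chosen measurably). Given data $x_{1:n}$, the approximate posterior $\nu_n$ is the law of the random probability measure $\mathbb{P}=\sum_{i=1}^n w_i\delta_{x_i}+\sum_{k=1}^T\tilde w_k\delta_{\tilde x_k}$, where $\tilde x_1,\dots,\tilde x_T$ are i.i.d. with law $\mathbb{F}$, independent of the weights $(w_1,\dots,w_n,\tilde w_1,\dots,\tilde w_T)\sim\mathrm{Dirichlet}(1,\dots,1,\tfrac{\alpha}{T},\dots,\tfrac{\alpha}{T})$ ($n$ parameters equal to $1$ and $T$ equal to $\alpha/T$). *)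

(* Defs.v *)
From HB Require Import structures.
From mathcomp Require Import all_boot all_order all_algebra.
From mathcomp Require Import all_classical all_reals all_analysis.
Set Implicit Arguments. Unset Strict Implicit. Unset Printing Implicit Defensive.
Import Order.TTheory GRing.Theory Num.Theory.
Import numFieldNormedType.Exports.
Local Open Scope classical_set_scope.
Local Open Scope ring_scope.

Section Defs.
Context (d : measure_display) (X : measurableType d) (R : realType).

(* k is a (real) reproducing kernel: symmetric and positive semi-definite
   (Moore--Aronszajn). *)
Definition rkernel (k : X -> X -> R) : Prop :=
  (forall x y, k x y = k y x) /\
  (forall (m : nat) (c : 'I_m -> R) (x : 'I_m -> X),
      0 <= \sum_(i < m) \sum_(j < m) c i * c j * k (x i) (x j)).

(* <mu_P, mu_Q>_{H_k} = \int\int k(x,y) P(dx) Q(dy) *)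
Definition kint (k : X -> X -> R) (P Q : {measure set X -> \bar R}) : R :=
  fine (\int[P]_x \int[Q]_y (k x y)%:E).

(* MMD^2(P,Q) = || mu_P - mu_Q ||^2_{H_k} *)
Definition mmd2 (k : X -> X -> R) (P Q : {measure set X -> \bar R}) : R :=
  kint k P P - 2 * kint k P Q + kint k Q Q.

Definition mmd (k : X -> X -> R) (P Q : {measure set X -> \bar R}) : R :=
  Num.sqrt (mmd2 k P Q).

Fixpoint iid_expect (mu : {measure set X -> \bar R}) (m : nat)
    (F : seq X -> \bar R) : \bar R :=
  match m with
  | 0%N => F [::]
  | m'.+1 => (\int[mu]_y iid_expect mu m' (fun s => F (y :: s)))%E
  end.

(* the discrete measure \sum_i w_i \delta_{a_i}  (weights are >= 0 where used;
   the absolute value only serves to give them type {nonneg R}) *)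
Fixpoint dmeasure (s : seq (R * X)) : {measure set X -> \bar R} :=
  match s with
  | [::] => mzero
  | (w, a) :: s' => measure_add (mscale (`|w|)%:nng (\d_a)) (dmeasure s')
  end.

End Defs.

Section Dirichlet.
Context (R : realType).

Definition gammaF (a : R) : R :=
  fine (\int[@lebesgue_measure R]_(x in [set x : R | (0 < x)%R])
          (x `^ (a - 1) * expR (- x))%:E).

Definition gamma_pdf (a x : R) : R := x `^ (a - 1) * expR (- x) / gammaF a.

Fixpoint gamma_expect (as_ : seq R) (F : seq R -> \bar R) : \bar R :=
  match as_ with
  | [::] => F [::]
  | a :: as' => (\int[@lebesgue_measure R]_(g in [set x : R | (0 < x)%R])
                   ((gamma_pdf a g)%:E * gamma_expect as' (fun s => F (g :: s))))%E
  end.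

(* expectation of F(w) with w ~ Dirichlet(a_1,...,a_N), realised as the law of
   (g_i / sum_j g_j)_i with g_i ~ Gamma(a_i,1) independent *)
Definition dirichlet_expect (as_ : seq R) (F : seq R -> \bar R) : \bar R :=
  gamma_expect as_ (fun g => F [seq gi / \sum_(h <- g) h | gi <- g]).

End Dirichlet.

(* E_{P ~ nu_n}[G(P)] given the data xs = x_{1:n}:
   P = sum_i w_i delta_{x_i} + sum_k w~_k delta_{x~_k}, x~_k iid ~ Fm,
   (w, w~) ~ Dirichlet(1,...,1, alpha/T,...,alpha/T), independent. *)
Definition nu_expect (d : measure_display) (X : measurableType d) (R : realType)
    (alpha : R) (T : nat) (Fm : {measure set X -> \bar R}) (xs : seq X)
    (G : {measure set X -> \bar R} -> \bar R) : \bar R :=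
  iid_expect Fm T (fun xt =>
    dirichlet_expect (nseq (size xs) 1 ++ nseq T (alpha / T%:R))
      (fun w => G (dmeasure (zip w (xs ++ xt))))).

(* Main.v *)
(* Integrated against the kernel, measures of mass one behave like vectors of a
   semi-inner product space: positivity of the kernel on samples of size [m]
   passes to the limit, so [kint] has nonnegative Gram matrices and [mmd] satisfies
   the triangle inequality.  With [P_n] the empirical measure of the data,
   minimality of [thetastar P] therefore gives
     mmd(P0, P_thetastar(P)) <= mmd(P0, P_theta) + 2 mmd(P0, P_n) + 2 mmd(P_n, P).
   The mean of [mmd2(P0, P_n)] over the data is at most [1 / n].  Uniformly in the
   sample points, [mmd(P_n, P)] is at most the norm of the combination with
   coefficients [w_i - 1/n] plus the total weight of the pseudo-samples, that is
   [1 - \sum_i w_i]; so only the first two moments of the [n] data weights are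
   needed.  They follow from [p! / S^(p+1) = \int_0^oo t^p exp(-tS) dt], which
   decouples the independent Gamma variables with sum [S].
   The bound [2 sqrt x <= x / s + s] replaces Jensen's inequality.  Nothing makes
   [thetastar] measurable, so the left-hand side is an iterated lower integral; it
   is dominated pointwise, and only the dominating functions are integrated. *)

Require Import Defs.
From HB Require Import structures.
From mathcomp Require Import all_boot all_order all_algebra.
From mathcomp Require Import ring lra.
From mathcomp Require Import all_classical all_reals all_analysis.
From mathcomp Require Import measurable_realfun.
Import Order.TTheory GRing.Theory Num.Theory.
Import numFieldNormedType.Exports.
Local Open Scope classical_set_scope.
Local Open Scope ring_scope.
Set Implicit Arguments. Unset Strict Implicit. Unset Printing Implicit Defensive.

(** * Bounded measurable functions and kernels *)

Section BoundedMeasurable.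
Context (d : measure_display) (X : measurableType d) (R : realType).

(** One class for all integrability side conditions: it is stable under linear combinations, and its
    members are integrable against every measure of finite mass. *)
Definition bmeas (f : X -> R) : Prop :=
  measurable_fun setT f /\ exists B : R, forall x, `|f x| <= B.

Lemma bmeas_cst (c : R) : bmeas (fun=> c).
Proof. by split; [exact: measurable_cst|exists `|c|]. Qed.

Lemma bmeasD (f g : X -> R) : bmeas f -> bmeas g -> bmeas (fun x => f x + g x).
Proof.
move=> [mf [B fB]] [mg [C gC]]; split; first exact: measurable_funD.
by exists (B + C) => x; rewrite (le_trans (ler_normD _ _))// lerD.
Qed.

Lemma bmeasZ (c : R) (f : X -> R) : bmeas f -> bmeas (fun x => c * f x).
Proof.
move=> [mf [B fB]]; split; first exact: measurable_funM.
by exists (`|c| * B) => x; rewrite normrM ler_wpM2l.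
Qed.

Lemma bmeas_sum (I : Type) (s : seq I) (F : I -> X -> R) :
  (forall i, bmeas (F i)) -> bmeas (fun x => \sum_(i <- s) F i x).
Proof.
move=> bF; elim: s => [|i s IH].
  by under eq_fun do rewrite big_nil; exact: bmeas_cst.
by under eq_fun do rewrite big_cons; exact: bmeasD.
Qed.

Lemma bmeas_integrable (mu : {measure set X -> \bar R}) (f : X -> R) :
  (mu setT < +oo)%E -> bmeas f -> mu.-integrable setT (EFin \o f).
Proof.
move=> muT [mf [B fB]]; apply: measurable_bounded_integrable => //.
exists B; split; first exact: num_real.
by move=> M BM x _ /=; apply: le_trans (fB x) (ltW BM).
Qed.

Variable P : probability X R.

Lemma probT_lty : (P setT < +oo)%E.
Proof. by rewrite probability_setT ltry. Qed.

Lemma EFin_Rintegral (f : X -> R) : bmeas f ->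
  (\int[P]_x (f x)%:E)%E = (\int[P]_x f x)%:E.
Proof.
move=> bf; rewrite /Rintegral fineK//; apply: integrable_fin_num => //.
exact: bmeas_integrable probT_lty bf.
Qed.

Lemma prob_int_cst (c : R) : \int[P]_x c = c.
Proof.
rewrite Rintegral_cst//.
have -> : fine (P setT) = 1. by rewrite probability_setT.
by rewrite mulr1.
Qed.

Lemma prob_intD (f g : X -> R) : bmeas f -> bmeas g ->
  \int[P]_x (f x + g x) = \int[P]_x f x + \int[P]_x g x.
Proof.
by move=> bf bg; rewrite RintegralD//; apply: bmeas_integrable => //; exact: probT_lty.
Qed.

Lemma prob_intZ (c : R) (f : X -> R) : bmeas f ->
  \int[P]_x (c * f x) = c * \int[P]_x f x.
Proof.
by move=> bf; rewrite RintegralZl//; apply: bmeas_integrable => //; exact: probT_lty.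
Qed.

Lemma prob_int_sum (I : Type) (s : seq I) (F : I -> X -> R) :
  (forall i, bmeas (F i)) ->
  \int[P]_x (\sum_(i <- s) F i x) = \sum_(i <- s) \int[P]_x F i x.
Proof.
move=> bF; elim: s => [|i s IH].
  by under eq_Rintegral do rewrite big_nil; rewrite prob_int_cst big_nil.
under eq_Rintegral do rewrite big_cons.
by rewrite big_cons prob_intD ?IH//; exact: bmeas_sum.
Qed.

Lemma prob_int_norm (f : X -> R) (B : R) : bmeas f -> (forall x, `|f x| <= B) ->
  `|\int[P]_x f x| <= B.
Proof.
move=> bf fB; have If : P.-integrable setT (EFin \o f).
  exact: bmeas_integrable probT_lty bf.
apply: (le_trans (le_normr_Rintegral _ If)) => //.
rewrite -[leRHS]prob_int_cst; apply: le_Rintegral => //.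
- by have := integrable_norm If.
- by apply: bmeas_integrable (bmeas_cst B); exact: probT_lty.
Qed.

End BoundedMeasurable.
Arguments bmeas {d X R}.

(** * Kernel means and double integrals of the kernel *)

Section Kernel.
Context (d : measure_display) (X : measurableType d) (R : realType).
Variables (k : X -> X -> R).
Hypothesis mk : measurable_fun setT (fun p : X * X => k p.1 p.2).
Hypothesis k1 : forall x y, `|k x y| <= 1.
Implicit Types P Q S : probability X R.

Lemma bmeas_kl x : bmeas (k x).
Proof.
split; last by exists 1.
exact: (measurable_fun_pair2 _ mk).
Qed.

Lemma bmeas_kr y : bmeas (k ^~ y).
Proof.
split; last by exists 1.
exact: (measurable_fun_pair1 _ mk).
Qed.

Lemma bmeas_kdiag : bmeas (fun x => k x x).
Proof.
split; last by exists 1.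
exact: (measurableT_comp mk (measurable_fun_pair (@measurable_id _ X setT) (@measurable_id _ X setT))).
Qed.

Lemma integrable_kernel P Q :
  (P \x Q)%E.-integrable setT (fun p : X * X => (k p.1 p.2)%:E).
Proof.
apply: (@bmeas_integrable _ _ _ _ (fun p : X * X => k p.1 p.2)).
  rewrite [ltLHS](_ : _ = 1%E) ?ltry//.
  exact: (@probability_setT _ _ _ (P \x Q)%E).
by split => //; exists 1.
Qed.

(** This function is the kernel mean embedding of [Q]; its measurability is that of a partial
    integral in Fubini's theorem. *)
Lemma bmeas_mean Q : bmeas (fun x => \int[Q]_y k x y).
Proof.
split; last first.
  exists 1 => x; apply: prob_int_norm; [exact: bmeas_kl|by []].
have := measurable_fubini_F (integrable_kernel Q Q).
rewrite /fubini_F /= => mF; apply/measurable_EFinP.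
by move: mF; congr measurable_fun; apply/funext => x /=;
  rewrite EFin_Rintegral//; exact: bmeas_kl.
Qed.

Lemma kintE P Q : kint k P Q = \int[P]_x \int[Q]_y k x y.
Proof.
rewrite /kint; congr fine; apply: eq_integral => x _.
by rewrite EFin_Rintegral//; exact: bmeas_kl.
Qed.

Lemma kintC P Q : (forall x y, k x y = k y x) -> kint k P Q = kint k Q P.
Proof.
move=> ksym; rewrite /kint (Fubini (integrable_kernel P Q))/=.
by congr fine; apply: eq_integral => x _; apply: eq_integral => y _; rewrite ksym.
Qed.

(** Mean of the kernel at two equal arguments, as against [kint k P P], where the arguments are
    independent; it collects the diagonal terms of a sampled double sum. *)
Definition kdiag P : R := \int[P]_x k x x.

Lemma kdiag_norm P : `|kdiag P| <= 1.
Proof. by apply: prob_int_norm => //; exact: bmeas_kdiag. Qed.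

End Kernel.

(** * Independent samples from a list of measures *)

Section MixedSamples.
Context (d : measure_display) (X : measurableType d) (R : realType).
Implicit Types (P Q S : probability X R) (L : seq (R * probability X R)).

(** Each coordinate may have its own law, so that samples from several measures can be averaged
    together in [gram3_ge0]. *)
Fixpoint mix_expect (Ps : seq (probability X R)) (F : seq X -> \bar R) : \bar R :=
  match Ps with
  | [::] => F [::]
  | P :: Ps' => (\int[P]_y mix_expect Ps' (fun s => F (y :: s)))%E
  end.

Lemma eq_mix_expect Ps (F G : seq X -> \bar R) :
  (forall s, size s = size Ps -> F s = G s) -> mix_expect Ps F = mix_expect Ps G.
Proof.
elim: Ps F G => [|P Ps IH] F G FG /=; first exact: FG.
by apply: eq_integral => y _; apply: IH => s sz; apply: FG; rewrite /= sz.
Qed.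

Lemma iid_expectE P n (F : seq X -> \bar R) :
  iid_expect P n F = mix_expect (nseq n P) F.
Proof.
elim: n F => [//|n IH] F /=.
by apply: eq_integral => y _; rewrite IH.
Qed.

Lemma mix_expect_ge0 Ps (F : seq X -> \bar R) :
  (forall s, size s = size Ps -> 0 <= F s)%E -> (0 <= mix_expect Ps F)%E.
Proof.
elim: Ps F => [|P Ps IH] F F0 /=; first exact: F0.
by apply: integral_ge0 => y _; apply: IH => s sz; apply: F0; rewrite /= sz.
Qed.

(* The double sum [\sum_i \sum_j c_i c_j h(x_i, x_j)] with each off-diagonal
   pair counted twice in list order, so that it makes sense for any [h]. *)
Fixpoint quad (h : X -> X -> R) (s : seq (R * X)) : R :=
  match s with
  | [::] => 0
  | q :: s' => q.1 ^+ 2 * h q.2 q.2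
               + 2 * q.1 * (\sum_(p <- s') p.1 * h q.2 p.2) + quad h s'
  end.

Variables (h : X -> X -> R).
Hypothesis mh : measurable_fun setT (fun p : X * X => h p.1 p.2).
Hypothesis h1 : forall x y, `|h x y| <= 1.

(** The mean of [quad] at independent points: equal indices give [kdiag], distinct ones [kint]. *)
Fixpoint mean_quad L : R :=
  match L with
  | [::] => 0
  | q :: L' => q.1 ^+ 2 * kdiag h q.2
               + 2 * q.1 * (\sum_(p <- L') p.1 * kint h q.2 p.2) + mean_quad L'
  end.

(** The affine part, given by [a] and [u], is there for the induction: once the first point is
    fixed, its cross terms with the other points are linear in them and are absorbed into [u]. *)
Lemma mix_expect_quad L (a b : R) (u : X -> R) : bmeas u ->
  mix_expect (map snd L) (fun s =>
    (a + \sum_(q <- zip (map fst L) s) q.1 * u q.2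
       + b * quad h (zip (map fst L) s))%:E)
  = (a + \sum_(q <- L) q.1 * \int[q.2]_x u x + b * mean_quad L)%:E.
Proof.
elim: L a u => [|[c P] L IH] a u bu /=; first by rewrite !big_nil.
have bh y : bmeas (h y) by exact: bmeas_kl mh h1 y.
have bhQ Q : bmeas (fun x => \int[Q]_y h x y) by exact: bmeas_mean mh h1 Q.
transitivity (\int[P]_y ((a + c * u y + b * c ^+ 2 * h y y
    + \sum_(q <- L) q.1 * \int[q.2]_x (u x + 2 * b * c * h y x)
    + b * mean_quad L)%:E))%E.
  apply: eq_integral => y _; rewrite -(IH (a + c * u y + b * c ^+ 2 * h y y)
    (fun x => u x + 2 * b * c * h y x)); last first.
    by apply: bmeasD => //; exact: bmeasZ.
  congr mix_expect; apply/funext => s; congr EFin; rewrite big_cons /=.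
  under [in RHS]eq_bigr do rewrite mulrDr.
  rewrite big_split /= mulr_sumr.
  have -> : \sum_(q <- zip [seq i.1 | i <- L] s) q.1 * (2 * b * c * h y q.2)
      = b * \sum_(q <- zip [seq i.1 | i <- L] s) 2 * c * (q.1 * h y q.2).
    by rewrite mulr_sumr; apply: eq_bigr => q _; ring.
  ring.
have E y : a + c * u y + b * c ^+ 2 * h y y
      + \sum_(q <- L) q.1 * \int[q.2]_x (u x + 2 * b * c * h y x) + b * mean_quad L
  = a + b * mean_quad L + \sum_(q <- L) q.1 * \int[q.2]_x u x + c * u y
    + b * c ^+ 2 * h y y + 2 * b * c * \sum_(q <- L) q.1 * \int[q.2]_x h y x.
  have -> : \sum_(q <- L) q.1 * \int[q.2]_x (u x + 2 * b * c * h y x)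
      = \sum_(q <- L) q.1 * \int[q.2]_x u x
        + 2 * b * c * \sum_(q <- L) q.1 * \int[q.2]_x h y x.
    rewrite mulr_sumr -big_split /=; apply: eq_bigr => q _.
    rewrite prob_intD//; last exact: bmeasZ.
    by rewrite prob_intZ//; ring.
  ring.
under eq_integral do rewrite E.
have bS : bmeas (fun y => \sum_(q <- L) q.1 * \int[q.2]_x h y x).
  by apply: bmeas_sum => q; exact: bmeasZ.
have bd : bmeas (fun y => h y y) by exact: bmeas_kdiag.
have b0 := @bmeas_cst _ X _ (a + b * mean_quad L + \sum_(q <- L) q.1 * \int[q.2]_x u x).
have b1 := bmeasD b0 (bmeasZ c bu).
have b2 := bmeasD b1 (bmeasZ (b * c ^+ 2) bd).
have b3 := bmeasD b2 (bmeasZ (2 * b * c) bS).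
rewrite EFin_Rintegral//; congr EFin.
rewrite prob_intD//; last exact: bmeasZ.
rewrite prob_intD//; last exact: bmeasZ.
rewrite prob_intD//; last exact: bmeasZ.
rewrite prob_int_cst !prob_intZ// prob_int_sum; last by move=> q; exact: bmeasZ.
rewrite big_cons /=.
under [X in _ + 2 * b * c * X = _]eq_bigr do rewrite prob_intZ// -kintE//.
by rewrite /kdiag; ring.
Qed.

(** The block has [m] diagonal terms and m (m - 1) ordered off-diagonal pairs, besides its cross
    terms with [L]. *)
Lemma mean_quad_nseq m (c : R) P L :
  mean_quad (nseq m (c, P) ++ L) =
  m%:R * c ^+ 2 * kdiag h P + m%:R * (m%:R - 1) * c ^+ 2 * kint h P P
  + 2 * m%:R * c * (\sum_(q <- L) q.1 * kint h P q.2) + mean_quad L.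
Proof.
elim: m => [|m IH] /=; first by rewrite !(mul0r, mulr0, add0r).
rewrite IH big_cat /= big_nseq iter_addr_0 -[_ *+ m]mulr_natl -natr1 /=.
ring.
Qed.

End MixedSamples.

(** * Gram matrices of measures *)

Section Gram.
Context (d : measure_display) (X : measurableType d) (R : realType).
Variables (k : X -> X -> R).
Hypothesis mk : measurable_fun setT (fun p : X * X => k p.1 p.2).
Hypothesis k1 : forall x y, `|k x y| <= 1.
Hypothesis kk : rkernel k.
Implicit Types P Q S : probability X R.

Lemma quad_sum (s : seq (R * X)) :
  quad k s = \sum_(p <- s) \sum_(q <- s) p.1 * q.1 * k p.2 q.2.
Proof.
elim: s => [|q s IH] /=; first by rewrite big_nil.
rewrite big_cons big_cons IH.
under [X in _ = _ + X]eq_bigr do rewrite big_cons.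
rewrite big_split /=.
have -> : \sum_(i <- s) i.1 * q.1 * k i.2 q.2 = q.1 * \sum_(p <- s) p.1 * k q.2 p.2.
  by rewrite mulr_sumr; apply: eq_bigr => i _; rewrite (kk.1 i.2); ring.
have -> : \sum_(j <- s) q.1 * j.1 * k q.2 j.2 = q.1 * \sum_(p <- s) p.1 * k q.2 p.2.
  by rewrite mulr_sumr; apply: eq_bigr => i _; ring.
ring.
Qed.

Lemma quad_ge0 (s : seq (R * X)) : 0 <= quad k s.
Proof.
case: s => [//|q0 s0]; set s := q0 :: s0.
rewrite quad_sum (big_nth q0) big_mkord.
under eq_bigr do rewrite (big_nth q0) big_mkord.
exact: (kk.2 (size s) (fun i => (nth q0 s i).1) (fun i => (nth q0 s i).2)).
Qed.

(** A mean of the nonnegative values of [quad]. *)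
Lemma mean_quad_ge0 (L : seq (R * probability X R)) : 0 <= mean_quad k L.
Proof.
have := mix_expect_quad mk k1 L 0 1 (bmeas_cst X 0).
rewrite [X in _ = (_ + X + _)%:E]big1 => [|q _]; last by rewrite prob_int_cst mulr0.
rewrite !add0r mul1r -lee_fin => <-; apply: mix_expect_ge0 => s _.
by rewrite big1 ?add0r ?mul1r ?lee_fin ?quad_ge0// => q _; rewrite mulr0.
Qed.

(** If [a] were negative, then [m = 1] (when [b <= 0]) or an integer above [b / - a] would make the
    hypothesis fail. *)
Lemma ge0_of_harmonic (a b : R) : (forall m, (0 < m)%N -> 0 <= a + b / m%:R) -> 0 <= a.
Proof.
move=> ab; rewrite leNgt; apply/negP => a0.
have [b0|b0] := leP b 0.
  by have := ab 1%N isT; rewrite divr1; lra.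
have mub : b / - a < (Num.bound (b / - a))%:R.
  by apply: archi_boundP; rewrite divr_ge0//; lra.
set m := Num.bound _ in mub.
have m0 : (0 : R) < m%:R by apply: le_lt_trans mub; rewrite divr_ge0//; lra.
have := ab m; rewrite -(ltr0n R) => /(_ m0).
rewrite ltr_pdivrMr in mub; last lra.
rewrite -(pmulr_rge0 _ m0) mulrDr mulrCA divff ?gt_eqF// mulr1; nra.
Qed.

(* Sampling [m] points from each of the three measures, with weights [c_i / m],
   turns positivity of the kernel on point sets into positivity on measures, up
   to diagonal terms of order [1 / m]. *)
Lemma gram3_ge0 P Q S (a b c : R) :
  0 <= a ^+ 2 * kint k P P + b ^+ 2 * kint k Q Q + c ^+ 2 * kint k S S
     + 2 * a * b * kint k P Q + 2 * a * c * kint k P S + 2 * b * c * kint k Q S.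
Proof.
(* The second argument is the coefficient of 1/m: with weights a/m the diagonal terms total a^2/m,
   and the off-diagonal ones m (m - 1) (a/m)^2 = a^2 - a^2/m. *)
apply: (@ge0_of_harmonic _ (a ^+ 2 * (kdiag k P - kint k P P)
  + b ^+ 2 * (kdiag k Q - kint k Q Q) + c ^+ 2 * (kdiag k S - kint k S S))) => m m0.
have m0' : m%:R != 0 :> R by rewrite pnatr_eq0 -lt0n.
have := mean_quad_ge0 (nseq m (a / m%:R, P) ++ (nseq m (b / m%:R, Q)
  ++ (nseq m (c / m%:R, S) ++ [::]))).
rewrite !mean_quad_nseq !big_cat /= !big_nseq !big_nil !(addr0, mulr0) /=.
have iterE (x : R) : iter m (GRing.add x) 0 = m%:R * x.
  by rewrite iter_addr_0 mulr_natl.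
rewrite !iterE.
move: (kdiag k P) (kdiag k Q) (kdiag k S) => dP dQ dS.
move: (kint k P P) (kint k Q Q) (kint k S S) (kint k P Q) (kint k P S) (kint k Q S).
move=> pp qq ss pq ps qs; congr (_ <= _).
by field.
Qed.

Lemma kint_ge0 P : 0 <= kint k P P.
Proof.
by have := gram3_ge0 P P P 1 0 0; rewrite !(mul0r, mulr0, addr0) expr1n expr0n /= mul1r !mul0r !addr0.
Qed.

Lemma mmd2_ge0 P Q : 0 <= mmd2 k P Q.
Proof. have := gram3_ge0 P Q Q 1 (-1) 0; rewrite /mmd2; lra. Qed.

Lemma mmd2C P Q : mmd2 k P Q = mmd2 k Q P.
Proof. by rewrite /mmd2 (kintC mk k1 P Q kk.1); ring. Qed.

Lemma mmdC P Q : mmd k P Q = mmd k Q P.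
Proof. by rewrite /mmd mmd2C. Qed.

(* The hypothesis says that [[a, b], [b, c]] is the Gram matrix of two vectors. *)
Lemma sqrt_gram_triangle (a b c : R) :
  (forall s t, 0 <= s ^+ 2 * a + 2 * s * t * b + t ^+ 2 * c) ->
  Num.sqrt (a + 2 * b + c) <= Num.sqrt a + Num.sqrt c.
Proof.
move=> psd; have a0 : 0 <= a by have := psd 1 0; lra.
have c0 : 0 <= c by have := psd 0 1; lra.
rewrite -[leRHS]ger0_norm ?addr_ge0 ?sqrtr_ge0// -sqrtr_sqr; apply: ler_wsqrtr.
have -> : (Num.sqrt a + Num.sqrt c) ^+ 2 = a + 2 * (Num.sqrt a * Num.sqrt c) + c.
  by rewrite sqrrD !sqr_sqrtr// -mulr_natl; ring.
suff : b <= Num.sqrt a * Num.sqrt c by lra.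
rewrite -sqrtrM//; apply: (le_trans (ler_norm _)).
rewrite -sqrtr_sqr; apply: ler_wsqrtr.
(* If [a] vanishes, the form is affine in [t] at [s = 0] or [s = 1], which forces [b = 0]: otherwise
   the [t] chosen below would give it the value -1. *)
have [a_eq0|a_gt0] : a = 0 \/ 0 < a by move: a0; rewrite le_eqVlt => /orP[/eqP|]; auto.
  have h (t : R) : 0 <= 2 * t * b + c.
    by have := psd t 1; rewrite a_eq0; lra.
  have [->|b0] := eqVneq b 0; first by rewrite a_eq0 expr0n mul0r.
  have := h (- (c + 1) / (2 * b)).
  have -> : 2 * (- (c + 1) / (2 * b)) * b + c = -1.
    by field.
  lra.
(* With [s = - b] and [t = a] the combination is orthogonal to the first vector, and positivity
   becomes the Cauchy-Schwarz inequality. *)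
have := psd (- b) a.
have -> : (- b) ^+ 2 * a + 2 * - b * a * b + a ^+ 2 * c = a * (a * c - b ^+ 2) by ring.
rewrite pmulr_rge0//; lra.
Qed.

(** The middle coefficient in the proof is the inner product of mu_P - mu_Q and mu_Q - mu_S. *)
Lemma mmd_triangle P Q S : mmd k P S <= mmd k P Q + mmd k Q S.
Proof.
rewrite /mmd; have := @sqrt_gram_triangle (mmd2 k P Q)
  (kint k P Q - kint k P S - kint k Q Q + kint k Q S) (mmd2 k Q S).
rewrite (_ : mmd2 k P Q + 2 * _ + _ = mmd2 k P S); last by rewrite /mmd2; ring.
(* The vector s (mu_P - mu_Q) + t (mu_Q - mu_S) has coefficients s, t - s and -t. *)
apply=> s t; have := gram3_ge0 P Q S s (t - s) (- t).
by congr (_ <= _); rewrite /mmd2; ring.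
Qed.

End Gram.

(** * Discrete measures *)

Section DiscreteMeasure.
Context (d : measure_display) (X : measurableType d) (R : realType).
Implicit Types s : seq (R * X).

(** Discrete measures carry only the structure of a measure; repackaging those of mass one makes the
    results on [probability] apply to them. *)
Lemma measure_probability (nu : {measure set X -> \bar R}) :
  nu setT = 1%E -> exists P : probability X R, (P : {measure set X -> \bar R}) = nu.
Proof.
case: nu => nu cnu nu1.
pose m : {measure set X -> \bar R} := Measure.Pack cnu.
pose P : probability X R := HB.pack nu cnu (Measure_isProbability.Build _ _ _ m nu1).
exists P.
congr (@Measure.Pack _ _ _ _ _).
Qed.

Lemma dmeasure_setT s : dmeasure s setT = (\sum_(q <- s) `|q.1|)%:E.
Proof.
elim: s => [|[w x] s IH]; first by rewrite big_nil.
rewrite big_cons /= /measure_add/= /msum !big_ord_recr big_ord0 /= add0e IH.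
by rewrite /mscale /= diracT mule1 EFinD.
Qed.

Lemma ge0_dmeasure_int s (f : X -> R) : measurable_fun setT f -> (forall x, 0 <= f x) ->
  (\int[dmeasure s]_x (f x)%:E)%E = (\sum_(q <- s) `|q.1| * f q.2)%:E.
Proof.
move=> mf f0; have mEf : measurable_fun setT (EFin \o f) by exact/measurable_EFinP.
elim: s => [|[w x] s IH]; first by rewrite big_nil integral_measure_zero.
rewrite big_cons /= ge0_integral_measure_add//; last by move=> y _; rewrite lee_fin.
rewrite IH ge0_integral_mscale//; last by move=> y _; rewrite lee_fin.
by rewrite integral_dirac//= diracT mul1e EFinD EFinM.
Qed.

Lemma dmeasure_int s (f : X -> R) : bmeas f ->
  (\int[dmeasure s]_x (f x)%:E)%E = (\sum_(q <- s) `|q.1| * f q.2)%:E.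
Proof.
move=> bf; have [mf [B fB]] := bf.
(* Adding the bound [B] reduces to a nonnegative integrand; the integral of the constant is
   subtracted at the end. *)
have B0 x : 0 <= f x + B by have := fB x; rewrite ler_norml; lra.
have mB : measurable_fun setT (fun x => f x + B) by exact: measurable_funD.
have := ge0_dmeasure_int s mB B0.
under eq_integral do rewrite EFinD.
rewrite integralD//=; last 2 first.
- by apply: bmeas_integrable bf; rewrite dmeasure_setT ltry.
- by apply: (bmeas_integrable _ (bmeas_cst X B)); rewrite dmeasure_setT ltry.
under [in RHS]eq_bigr do rewrite mulrDr.
rewrite big_split /= integral_cst// dmeasure_setT -mulr_suml [in RHS]EFinD => /eqP.
rewrite [(_ * B)%R]mulrC EFinM => /eqP/(congr1 (fun z => z - (B%:E * (\sum_(q <- s) `|q.1|)%:E))%E).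
by rewrite !addeK.
Qed.

End DiscreteMeasure.

Section DiscreteMMD.
Context (d : measure_display) (X : measurableType d) (R : realType).
Variables (k : X -> X -> R).
Hypothesis mk : measurable_fun setT (fun p : X * X => k p.1 p.2).
Hypothesis k1 : forall x y, `|k x y| <= 1.
Hypothesis kk : rkernel k.
Implicit Types (P : probability X R) (s t : seq (R * X)).

(** The inner product of the kernel combinations that two weighted lists represent. Weights may be
    negative here, whereas [dmeasure] takes their absolute values. *)
Definition pairing s t : R := \sum_(p <- s) \sum_(q <- t) p.1 * q.1 * k p.2 q.2.

Lemma kint_dmeasure s t : (forall q, q \in [seq p.1 | p <- s] -> 0 <= q) ->
  (forall q, q \in [seq p.1 | p <- t] -> 0 <= q) ->
  kint k (dmeasure s) (dmeasure t) = pairing s t.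
Proof.
move=> s0 t0; rewrite /kint.
under eq_integral do rewrite (dmeasure_int t (bmeas_kl mk k1 _)).
rewrite dmeasure_int; last first.
  by apply: bmeas_sum => q; apply: bmeasZ; exact: bmeas_kr.
rewrite /pairing /= !big_seq; apply: eq_bigr => p ps.
rewrite ger0_norm; last by apply: s0; exact: map_f.
rewrite mulr_sumr !big_seq; apply: eq_bigr => q qt.
by rewrite ger0_norm ?mulrA//; apply: t0; exact: map_f.
Qed.

(** A constant, a linear and a quadratic part: the shape that [mix_expect_quad] averages. *)
Lemma mmd2_dmeasure P s : (forall q, q \in [seq p.1 | p <- s] -> 0 <= q) ->
  mmd2 k P (dmeasure s) =
  kint k P P + \sum_(q <- s) q.1 * (- 2 * \int[P]_y k y q.2) + quad k s.
Proof.
move=> s0; rewrite /mmd2 (kint_dmeasure s0 s0) (quad_sum kk) -/(pairing s s).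
suff -> : kint k P (dmeasure s) = \sum_(q <- s) q.1 * \int[P]_y k y q.2.
  rewrite mulr_sumr -sumrN; congr (_ + _ + _); apply: eq_bigr => q _; ring.
rewrite /kint.
under eq_integral do rewrite (dmeasure_int s (bmeas_kl mk k1 _)).
rewrite -/(Rintegral P setT (fun x => \sum_(q <- s) `|q.1| * k x q.2)).
rewrite prob_int_sum; last by move=> q; apply: bmeasZ; exact: bmeas_kr.
rewrite !big_seq; apply: eq_bigr => q qs.
rewrite prob_intZ ?ger0_norm//; last exact: bmeas_kr.
by apply: s0; exact: map_f.
Qed.

End DiscreteMMD.

(** * Weighted lists as vectors, and the pointwise bound at a minimiser *)

Section PointwiseBound.
Context (d : measure_display) (X : measurableType d) (R : realType).
Variables (k : X -> X -> R).
Hypothesis mk : measurable_fun setT (fun p : X * X => k p.1 p.2).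
Hypothesis k1 : forall x y, `|k x y| <= 1.
Hypothesis kk : rkernel k.
Implicit Types (P : probability X R) (s t : seq (R * X)).

Local Notation pairing := (pairing k).

Lemma pairingE s t :
  pairing s t = \sum_(p <- s) p.1 * (\sum_(q <- t) q.1 * k p.2 q.2).
Proof.
apply: eq_bigr => p _; rewrite mulr_sumr; apply: eq_bigr => q _; by rewrite mulrA.
Qed.

Lemma pairingC s t : pairing s t = pairing t s.
Proof.
rewrite /pairing exchange_big /=; apply: eq_bigr => p _; apply: eq_bigr => q _.
by rewrite (kk.1 p.2) [p.1 * q.1]mulrC.
Qed.

Lemma pairing_catl s s' t : pairing (s ++ s') t = pairing s t + pairing s' t.
Proof. by rewrite !pairingE big_cat. Qed.

Lemma pairing_catr s t t' : pairing s (t ++ t') = pairing s t + pairing s t'.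
Proof. by rewrite pairingC pairing_catl (pairingC t) (pairingC t'). Qed.

Definition scale_weights (r : R) s := [seq (r * q.1, q.2) | q <- s].

Lemma pairing_scalel r s t : pairing (scale_weights r s) t = r * pairing s t.
Proof.
rewrite !pairingE big_map mulr_sumr; apply: eq_bigr => p _ /=.
by rewrite mulrA.
Qed.

Lemma pairing_scaler r s t : pairing s (scale_weights r t) = r * pairing s t.
Proof. by rewrite pairingC pairing_scalel (pairingC t). Qed.

(** Concatenation is addition and [scale_weights] is scalar multiplication, so positivity of the
    kernel on weighted lists supplies the Gram hypothesis of [sqrt_gram_triangle]. *)
Lemma pairing_triangle s t :
  Num.sqrt (pairing (s ++ t) (s ++ t))
  <= Num.sqrt (pairing s s) + Num.sqrt (pairing t t).
Proof.
have := @sqrt_gram_triangle _ (pairing s s) (pairing s t) (pairing t t).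
have -> : pairing s s + 2 * pairing s t + pairing t t = pairing (s ++ t) (s ++ t).
  by rewrite pairing_catl !pairing_catr [pairing t s]pairingC; ring.
apply=> a b; have := quad_ge0 kk (scale_weights a s ++ scale_weights b t).
rewrite (quad_sum kk) -/(pairing _ _) pairing_catl !pairing_catr.
rewrite !(pairing_scalel, pairing_scaler) [pairing t s]pairingC.
by congr (_ <= _); ring.
Qed.

Lemma pairing_le_sqr s : pairing s s <= (\sum_(q <- s) `|q.1|) ^+ 2.
Proof.
rewrite expr2 mulr_suml; apply: ler_sum => p _.
rewrite mulr_sumr; apply: ler_sum => q _.
by rewrite (le_trans (ler_norm _))// !normrM -[leRHS]mulr1 ler_wpM2l ?mulr_ge0.
Qed.

(* [zip [seq w - c | w <- ws] xs] represents the difference of the two discrete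
   measures, so it can replace the formal difference of weighted lists. *)
Lemma pairing_shift (c : R) ws xs t : size ws = size xs ->
  pairing (zip [seq w - c | w <- ws] xs) t =
  pairing (zip ws xs) t - pairing (zip (nseq (size xs) c) xs) t.
Proof.
rewrite !pairingE; elim: ws xs => [|w ws IH] [|x xs] //=.
  by rewrite !big_nil subr0.
by case=> /IH; rewrite !big_cons /= => ->; ring.
Qed.

(** On the common points [xs] the difference of the two measures has weights [w - c]; the rest sits
    on [xt], where the bound on the kernel makes its norm at most its total mass. *)
Lemma mmd_dmeasure_shift (c : R) (w1 w2 : seq R) (xs xt : seq X) :
  size w1 = size xs -> 0 <= c ->
  (forall w, w \in w1 ++ w2 -> 0 <= w) -> size w2 = size xt ->
  mmd k (dmeasure (zip (nseq (size xs) c) xs)) (dmeasure (zip (w1 ++ w2) (xs ++ xt)))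
  <= Num.sqrt (quad k (zip [seq w - c | w <- w1] xs)) + \sum_(w <- w2) w.
Proof.
move=> sz1 c0 w0 sz2.
set A := zip _ xs; set D := zip _ (xs ++ xt); set E := zip (map _ _) xs.
have DE : D = zip w1 xs ++ zip w2 xt by rewrite /D zip_cat.
have A0 q : q \in [seq p.1 | p <- A] -> 0 <= q.
  by rewrite -/(unzip1 A) unzip1_zip ?size_nseq// => /nseqP[-> _].
have D0 q : q \in [seq p.1 | p <- D] -> 0 <= q.
  by rewrite -/(unzip1 D) unzip1_zip ?size_cat ?sz1 ?sz2//; exact: w0.
rewrite /mmd /mmd2 !(kint_dmeasure mk k1)//.
have -> : pairing A A - 2 * pairing A D + pairing D D
    = pairing (E ++ zip w2 xt) (E ++ zip w2 xt).
  rewrite DE !pairing_catl !pairing_catr.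
  rewrite /E !pairing_shift// -/A ![pairing _ (zip [seq _ | _ <- _] _)]pairingC.
  rewrite !pairing_shift// -/A (pairingC A (zip w1 xs)) (pairingC A (zip w2 xt)).
  by rewrite (pairingC (zip w2 xt) (zip w1 xs)); ring.
apply: (le_trans (pairing_triangle _ _)).
rewrite (quad_sum kk) -/(pairing _ _) lerD2l.
have W0 : 0 <= \sum_(w <- w2) w.
  by rewrite big_seq; apply: sumr_ge0 => w ww; apply: w0; rewrite mem_cat ww orbT.
rewrite -[leRHS]ger0_norm// -sqrtr_sqr; apply: ler_wsqrtr.
apply: (le_trans (pairing_le_sqr _)).
rewrite -(big_map fst xpredT (fun w => `|w|)) -/(unzip1 _) unzip1_zip ?sz2//.
rewrite [X in X ^+ 2](_ : _ = \sum_(w <- w2) w)//.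
rewrite !big_seq; apply: eq_bigr => w ww.
by rewrite ger0_norm// w0// mem_cat ww orbT.
Qed.

Variables (Theta : Type) (Ptheta : Theta -> probability X R).
Variable thetastar : {measure set X -> \bar R} -> Theta.
Hypothesis hthetastar : forall P : {measure set X -> \bar R}, P setT = 1%E ->
  forall th, mmd2 k P (Ptheta (thetastar P)) <= mmd2 k P (Ptheta th).

(** Going from [P0] to the minimiser through [nu], then by minimality from [nu] to [th] through
    [P0], uses the distance from [P0] to [nu] twice; that distance is then split at [eta]. *)
Lemma mmd_minimiser_le P0 th (nu eta : {measure set X -> \bar R}) :
  nu setT = 1%E -> eta setT = 1%E ->
  mmd k P0 (Ptheta (thetastar nu))
  <= mmd k P0 (Ptheta th) + 2 * mmd k P0 eta + 2 * mmd k eta nu.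
Proof.
move=> nu1 eta1; have := hthetastar nu1 th; move: (thetastar nu) => ths.
have [N <-] := measure_probability nu1; have [E <-] := measure_probability eta1.
move=> /(ler_wsqrtr) hN.
have := mmd_triangle mk k1 kk P0 N (Ptheta ths).
have := mmd_triangle mk k1 kk N P0 (Ptheta th).
have := mmd_triangle mk k1 kk P0 E N.
by rewrite (mmdC mk k1 kk N P0); move: hN; rewrite -![Num.sqrt _]/(mmd _ _ _); lra.
Qed.

End PointwiseBound.

(** * Integrals on the half line *)

Section LowerIntegral.
Context (d : measure_display) (X : measurableType d) (R : realType).
Variable mu : {measure set X -> \bar R}.
Local Open Scope ereal_scope.

(* No measurability: on nonnegative functions the library's integral is the
   supremum over the simple functions below. *)
Lemma ge0_le_integral_nonmeas (D : set X) (f g : X -> \bar R) :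
  (forall x, D x -> 0 <= f x <= g x) ->
  \int[mu]_(x in D) f x <= \int[mu]_(x in D) g x.
Proof.
move=> fg; rewrite !ge0_integralE; last 2 first.
- by move=> x /fg/andP[f0]; exact: le_trans.
- by move=> x /fg/andP[].
apply: ge_ereal_sup => _ [h hf <-]; apply: ereal_sup_ubound; exists h => //= x.
apply: le_trans (hf x) _; rewrite !patchE; case: ifPn => // /set_mem Dx.
by have /andP[] := fg _ Dx.
Qed.

End LowerIntegral.

Section HalfLine.
Context (R : realType).
Notation mu := (@lebesgue_measure R).

Definition posR : set R := [set x : R | 0 < x].

Lemma posRE : posR = `]0, +oo[%classic.
Proof. by apply/seteqP; split => x; rewrite /= in_itv/= andbT. Qed.

Lemma measurable_posR : measurable posR.
Proof. by rewrite posRE; exact: measurable_itv. Qed.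

Lemma half_line_FTC (f F : R -> R) (l : R) :
  (forall x, 0 <= x -> 0 <= f x) ->
  (forall x : R, -1 < x -> is_derive x (1 : R) F (f x)) ->
  (forall x : R, -1 < x -> {for x, continuous f}) ->
  F x @[x --> +oo] --> l ->
  (\int[mu]_(x in posR) (f x)%:E)%E = (l - F 0)%:E.
Proof.
move=> f0 dF cf Fl.
have cf0 : {in `]0, +oo[, continuous f}.
  by move=> x; rewrite in_itv/= andbT => x0; apply: cf; lra.
rewrite posRE integral_itv_obnd_cbnd; last first.
  apply/measurable_EFinP; apply: open_continuous_measurable_fun => //.
  by move=> x /set_mem; exact: cf0.
apply: ge0_continuous_FTC2y => //.
- apply/continuous_within_itvcyP; split => //.
  by apply: cvg_at_right_filter; apply: cf; lra.
- move=> x x0; have := dF x; rewrite (lt_trans _ x0); last lra.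
  by move=> /(_ isT) ?; exact: ex_derive.
- apply: cvg_at_right_filter.
  have h : is_derive (0 : R) (1 : R) F (f 0) by apply: dF; lra.
  exact/differentiable_continuous/derivable1_diffP/(@ex_derive _ _ _ _ _ _ _ h).
- move=> x; rewrite in_itv/= andbT => x0.
  have h : is_derive x (1 : R) F (f x) by apply: dF; lra.
  by rewrite derive1E derive_val.
Qed.

Lemma cvg0_le_inv (F : R -> R) (K : R) :
  (forall x, 0 < x -> `|F x| <= K / x) -> F x @[x --> +oo] --> 0.
Proof.
move=> FK; apply/cvgrPdist_le => e e0.
near=> x; rewrite sub0r normrN.
have x0 : 0 < x by near: x; exact: nbhs_pinfty_gt.
apply: (le_trans (FK _ x0)); by rewrite ler_pdivrMr// -ler_pdivrMl.
Unshelve. all: by end_near. Qed.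

(** The exponential series bounds x^(n+1) / (n+1)! by exp x, so the function is at most (n+1)! /
    x. *)
Lemma cvg_exprn_expRN n : (x ^+ n * expR (- x) : R) @[x --> +oo] --> 0.
Proof.
apply: (@cvg0_le_inv _ (n.+1)`!%:R) => x x0.
rewrite ger0_norm; last by rewrite mulr_ge0 ?expR_ge0 ?exprn_ge0// ltW.
rewrite expRN ler_pdivlMr// mulrAC -exprSr ler_pdivrMr ?expR_gt0//.
have := expR_ge1Dxn n (ltW x0).
have : (0 : R) < (n.+1)`!%:R by rewrite ltr0n fact_gt0.
move=> h1 h2; rewrite -ler_pdivrMl// mulrC; lra.
Qed.

(** Lebesgue measure is [c] times its image under multiplication by [c]: the two agree on half-open
    intervals, and these determine the measure. *)
Lemma integral_scale (c : R) (f : R -> R) : 0 < c ->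
  measurable_fun setT f -> (forall x, 0 <= f x) ->
  (\int[mu]_(x in posR) (f (c * x))%:E
   = c^-1%:E * \int[mu]_(x in posR) (f x)%:E)%E.
Proof.
move=> c0 mf f0.
have mc : measurable_fun [set: measurableTypeR R] (( *%R c) : _ -> measurableTypeR R).
  exact: mulrl_measurable.
pose nu' : {measure set measurableTypeR R -> \bar R} :=
  mscale (NngNum (ltW c0)) (pushforward mu (( *%R c) : _ -> measurableTypeR R)).
pose nu := nu' mc; have munu A : measurable A -> mu A = nu A.
  apply: lebesgue_measure_unique => _ [[a b]] _ <-.
  change (mu `]a, b] = (c%:E * mu (( *%R c) @^-1` `]a, b]))%E).
  rewrite (_ : _ @^-1` _ = `]a / c, b / c]%classic); last first.
    apply/seteqP; split => x /=; rewrite !in_itv/= ltr_pdivrMr// ler_pdivlMr//.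
      by rewrite mulrC.
    by rewrite mulrC.
  rewrite !lebesgue_measure_itv/= !lte_fin ltr_pM2r ?invr_gt0//.
  case: ifPn => // _; last by rewrite mule0.
  by rewrite -!EFinB -EFinM; congr EFin; field; rewrite gt_eqF.
have mEf : measurable_fun posR (EFin \o f).
  by apply/measurable_EFinP; exact: measurable_funS mf.
rewrite [in RHS](eq_measure_integral nu); last by move=> A mA _; exact: munu.
rewrite ge0_integral_mscale//; last 2 first.
- exact: measurable_posR.
- by move=> x _; rewrite lee_fin.
rewrite ge0_integral_pushforward//; last 2 first.
- exact: measurable_posR.
- by move=> x _; rewrite /= lee_fin.
rewrite (_ : _ @^-1` posR = posR); last first.
  by apply/seteqP; split => x /=; rewrite /posR/= pmulr_rgt0.
by rewrite muleA -EFinM mulVf ?gt_eqF// mul1e.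
Qed.

End HalfLine.

Section HalfLineIntegrals.
Context (R : realType).
Notation mu := (@lebesgue_measure R).
Notation pos := (@posR R).

Lemma half_line_patch (f : R * R -> \bar R) :
  ((fun p => f p) \_ (pos `*` pos))
  = (fun p => (if (0 < p.1)%R && (0 < p.2)%R then f p else 0%E)).
Proof.
apply/funext => -[x y]; rewrite patchE /=; case: ifPn => [/set_mem[/= x0 y0]|].
  by rewrite x0 y0.
by move=> /negP h; case: ifPn => // /andP[x0 y0]; exfalso; apply: h; apply/mem_set.
Qed.

(** Extension by zero outside the quadrant turns both sides into integrals over the plane, where
    Tonelli's theorem applies. *)
Lemma half_line_swap (f : R * R -> \bar R) : measurable_fun setT f ->
  (forall p, 0 <= f p)%E ->
  (\int[mu]_(x in pos) \int[mu]_(y in pos) f (x, y)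
   = \int[mu]_(y in pos) \int[mu]_(x in pos) f (x, y))%E.
Proof.
move=> mf f0; pose g := (fun p => f p) \_ (pos `*` pos).
have gE := half_line_patch f; rewrite -/g in gE.
have mg : measurable_fun setT g.
  apply/(measurable_restrictT _ _).1; last exact: measurable_funTS.
  by apply: measurableX; exact: measurable_posR.
have g0 p : (0 <= g p)%E by rewrite gE; case: ifP.
transitivity (\int[mu]_x \int[mu]_y g (x, y))%E.
  rewrite integral_mkcond; apply: eq_integral => x _; rewrite patchE.
  case: ifPn => [/set_mem x0|/negP x0].
    rewrite integral_mkcond; apply: eq_integral => y _; rewrite patchE gE /= (x0 : is_true (0 < x)) /=.
    case: ifPn => [/set_mem -> //|/negP y0].
    by case: ifPn => // y1; exfalso; apply: y0; apply/mem_set.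
  rewrite integral0_eq// => y _; rewrite gE /=; case: ifPn => // /andP[x1 _].
  by exfalso; apply: x0; apply/mem_set.
rewrite fubini_tonelli//.
rewrite [RHS]integral_mkcond; apply: eq_integral => y _; rewrite patchE.
case: ifPn => [/set_mem y0|/negP y0].
  rewrite [RHS]integral_mkcond; apply: eq_integral => x _; rewrite patchE gE /= (y0 : is_true (0 < y)) andbT.
  case: ifPn => x0; first by rewrite mem_set.
  by rewrite memNset// => x1; move: x0; rewrite (x1 : is_true (0 < x)).
rewrite integral0_eq// => x _; rewrite gE /=; case: ifPn => // /andP[_ x1].
by exfalso; apply: y0; apply/mem_set.
Qed.

Lemma measurable_half_line_integral (f : R * R -> \bar R) : measurable_fun setT f ->
  (forall p, 0 <= f p)%E ->
  measurable_fun setT (fun x => \int[mu]_(y in pos) f (x, y))%E.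
Proof.
move=> mf f0; pose g := (fun p => f p) \_ (setT `*` pos).
have mg : measurable_fun setT g.
  apply/(measurable_restrictT _ _).1; last exact: measurable_funTS.
  by apply: measurableX => //; exact: measurable_posR.
have g0 p : (0 <= g p)%E by rewrite /g patchE; case: ifP.
have := @measurable_fun_fubini_tonelli_F _ _ _ _ _ mu g mg g0.
congr measurable_fun; apply/funext => x; rewrite /fubini_F /=.
rewrite [RHS]integral_mkcond; apply: eq_integral => y _; rewrite /g !patchE.
case: ifPn => [/set_mem[_ y0]|/negP h]; first by rewrite mem_set.
by rewrite memNset// => y0; apply: h; apply/mem_set.
Qed.

Lemma cvg_poly2_expRN (a b c : R) :
  (- ((a * x ^+ 2 + b * x + c) * expR (- x)) : R) @[x --> +oo] --> 0.
Proof.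
have -> : (fun x : R => - ((a * x ^+ 2 + b * x + c) * expR (- x))) =
  (fun x : R => - (a * (x ^+ 2 * expR (- x)) + b * (x ^+ 1 * expR (- x))
                   + c * (x ^+ 0 * expR (- x)))).
  by apply/funext => x; rewrite expr1 expr0; ring.
rewrite -[X in _ --> X]oppr0; apply: cvgN.
have <- : a * 0 + b * 0 + c * 0 = 0 :> R by ring.
apply: cvgD; first apply: cvgD; (apply: cvgMr; exact: cvg_exprn_expRN).
Qed.

Lemma gamma_integral_nat m : (m <= 2)%N ->
  (\int[mu]_(x in pos) (x ^+ m * expR (- x))%:E = (m`!%:R)%:E)%E.
Proof.
move=> m2.
have cf (x : R) : {for x, continuous (fun x : R => x ^+ m * expR (- x))}.
  apply: (@continuousM _ _ (fun x : R => x ^+ m) (fun x : R => expR (- x))).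
    exact: exprn_continuous.
  by apply: (@continuous_comp _ _ _ -%R expR); [exact: opp_continuous|exact: continuous_expR].
have f0 (x : R) : 0 <= x -> 0 <= x ^+ m * expR (- x).
  by move=> x0; rewrite mulr_ge0 ?expR_ge0 ?exprn_ge0.
(* The antiderivative is minus a polynomial of degree at most two times exp(- x). It vanishes at
   infinity, so the integral is the constant coefficient [c]. *)
suff [a [b [c [dF cE]]]] : exists a b c : R, (forall x : R, is_derive x (1 : R)
    (fun x => - ((a * x ^+ 2 + b * x + c) * expR (- x))) (x ^+ m * expR (- x)))
    /\ c = m`!%:R.
  rewrite (half_line_FTC f0 (fun x _ => dF x) (fun x _ => cf x) (cvg_poly2_expRN a b c)).
  by rewrite oppr0 expR0 expr0n /= !mulr0 !add0r mulr1 opprK cE.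
case: m m2 {cf f0} => [|[|[|//]]] _.
- exists 0, 0, 1; split => // x; apply: is_derive_eq.
  rewrite /GRing.scale /=; ring.
- exists 0, 1, 1; split => // x; apply: is_derive_eq.
  rewrite /GRing.scale /=; ring.
- exists 1, 2, 2; split => // x; apply: is_derive_eq.
  rewrite /GRing.scale /=; ring.
Qed.

End HalfLineIntegrals.

(** * Gamma densities, their Laplace transforms, and integrals of powers of 1 + t *)

Section GammaIntegrals.
Context (R : realType).
Notation mu := (@lebesgue_measure R).
Notation pos := (@posR R).

Lemma measurable_normX_expRN (m : nat) :
  measurable_fun setT (fun x : R => `|x| ^+ m * expR (- x)).
Proof.
apply: measurable_funM.
  by apply: measurable_funX; exact: normr_measurable.
by apply: (measurableT_comp (@measurable_expR R)); exact: measurable_funN.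
Qed.

Lemma gamma_integral_rate (m : nat) (c : R) : (m <= 2)%N -> 0 < c ->
  (\int[mu]_(x in pos) (x ^+ m * expR (- (c * x)))%:E = (m`!%:R / c ^+ m.+1)%:E)%E.
Proof.
move=> m2 c0.
(* The absolute value makes the integrand nonnegative on the whole line, as [integral_scale]
   requires. *)
transitivity (\int[mu]_(x in pos) ((c ^- m)%:E * (`|c * x| ^+ m * expR (- (c * x)))%:E))%E.
  apply: eq_integral => x /set_mem x0; rewrite -EFinM; congr EFin.
  rewrite ger0_norm; last by rewrite mulr_ge0// ltW.
  by rewrite exprMn !mulrA mulVf ?mul1r// expf_neq0 ?gt_eqF.
rewrite ge0_integralZl//; last 3 first.
- exact: measurable_posR.
- apply/measurable_EFinP; apply: measurable_funTS.
  apply: (measurableT_comp (measurable_normX_expRN m)); exact: mulrl_measurable.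
- by rewrite lee_fin invr_ge0 exprn_ge0// ltW.
rewrite (integral_scale c0 (measurable_normX_expRN m)); last first.
  by move=> x; rewrite mulr_ge0 ?expR_ge0.
rewrite (_ : (\int[mu]_(x in pos) _)%E = (m`!%:R)%:E); last first.
  rewrite -gamma_integral_nat//; apply: eq_integral => x /set_mem x0.
  by rewrite ger0_norm// ltW.
rewrite -!EFinM; congr EFin; rewrite exprS invfM; ring.
Qed.

Lemma cvg_powRN (A : R) : 0 < A -> ((1 + t) `^ (- A) : R) @[t --> +oo] --> 0.
Proof.
move=> A0; apply/cvgrPdist_le => e e0.
near=> t; have t0 : 0 < t by near: t; exact: nbhs_pinfty_gt.
have te : e^-1 `^ A^-1 <= t by near: t; exact: nbhs_pinfty_ge.
rewrite sub0r normrN ger0_norm ?powR_ge0// powRN -[leRHS]invrK lef_pV2 ?posrE//; last 2 first.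
- by apply: powR_gt0; lra.
- by rewrite invr_gt0.
have -> : e^-1 = (e^-1 `^ A^-1) `^ A by rewrite -powRrM mulVf ?gt_eqF// powRr1// invr_ge0 ltW.
by apply: ge0_ler_powR; rewrite ?nnegrE ?powR_ge0//; lra.
Unshelve. all: by end_near. Qed.

Lemma is_derive_powR1D (p t : R) : -1 < t ->
  is_derive t (1 : R) (fun t => (1 + t) `^ p) (p * (1 + t) `^ (p - 1)).
Proof.
move=> t1; have t0 : 0 < 1 + t by lra.
have h1 : is_derive (1 + t) (1 : R) (fun x : R => x `^ p) (p * (1 + t) `^ (p - 1)).
  exact: is_derive1_powR.
have h2 : is_derive t (1 : R) (fun t : R => 1 + t) 1.
  by apply: is_derive_eq; ring.
have := @is_derive1_comp _ (fun x : R => x `^ p) (fun t : R => 1 + t) t _ _ h1 h2.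
by rewrite mulr1.
Qed.

Lemma continuous_powR1D (p t : R) : -1 < t ->
  {for t, continuous (fun t : R => (1 + t) `^ p)}.
Proof.
move=> t1; have h := is_derive_powR1D p t1.
exact/differentiable_continuous/derivable1_diffP/(@ex_derive _ _ _ _ _ _ _ h).
Qed.

Lemma integral_powR1D (A : R) : 0 < A ->
  (\int[mu]_(t in pos) ((1 + t) `^ (- (A + 1)))%:E = A^-1%:E)%E.
Proof.
move=> A0; have An0 : A != 0 by rewrite gt_eqF.
pose f (t : R) := (1 + t) `^ (- (A + 1)); pose F (t : R) := - A^-1 * (1 + t) `^ (- A).
have f0 (x : R) : 0 <= x -> 0 <= f x by move=> _; exact: powR_ge0.
have dF (x : R) : -1 < x -> is_derive x (1 : R) F (f x).
  move=> x1; have h := is_derive_powR1D (- A) x1.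
  apply: is_derive_eq; rewrite /GRing.scale /= mulrA mulrNN mulVf// mul1r.
  by rewrite /f opprD.
have cf (x : R) : -1 < x -> {for x, continuous f} by move=> x1; exact: continuous_powR1D.
have Fl : F x @[x --> +oo] --> 0.
  by rewrite -[X in _ --> X](mulr0 (- A^-1)); apply: cvgMr; exact: cvg_powRN.
rewrite (half_line_FTC f0 dF cf Fl) /F addr0 powR1 mulr1.
by rewrite sub0r opprK.
Qed.

(** A Beta integral; writing t = (1 + t) - 1 gives the antiderivative [F]. *)
Lemma integral_id_powR1D (A : R) : 0 < A ->
  (\int[mu]_(t in pos) (t * (1 + t) `^ (- (A + 2)))%:E = (A * (A + 1))^-1%:E)%E.
Proof.
move=> A0; have An0 : A != 0 by rewrite gt_eqF.
have A1n0 : A + 1 != 0 by rewrite gt_eqF//; lra.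
pose f (t : R) := t * (1 + t) `^ (- (A + 2)).
pose F (t : R) := - A^-1 * (1 + t) `^ (- A) + (A + 1)^-1 * (1 + t) `^ (- (A + 1)).
have f0 (x : R) : 0 <= x -> 0 <= f x by move=> x0; rewrite mulr_ge0 ?powR_ge0.
have dF (x : R) : -1 < x -> is_derive x (1 : R) F (f x).
  move=> x1; have h := is_derive_powR1D (- A) x1.
  have h' := is_derive_powR1D (- (A + 1)) x1.
  apply: is_derive_eq; rewrite /GRing.scale /= /f.
  have -> : - A - 1 = - (A + 2) + 1 :> R by ring.
  have -> : - (A + 1) - 1 = - (A + 2) :> R by ring.
  have x1n0 : 1 + x != 0 by rewrite gt_eqF//; lra.
  rewrite powRD; last by rewrite x1n0 implybT.
  rewrite powRr1; last lra.
  by field; rewrite A1n0.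
have cf (x : R) : -1 < x -> {for x, continuous f}.
  move=> x1; apply: (@continuousM _ _ id (fun t : R => (1 + t) `^ (- (A + 2)))).
    exact: cvg_id.
  exact: continuous_powR1D.
have Fl : F x @[x --> +oo] --> 0.
  have <- : - A^-1 * 0 + (A + 1)^-1 * 0 = 0 :> R by rewrite !mulr0 addr0.
  by apply: cvgD; apply: cvgMr; apply: cvg_powRN; lra.
rewrite (half_line_FTC f0 dF cf Fl) /F addr0 !powR1; congr EFin.
by field; rewrite A1n0.
Qed.

Lemma gamma_pdf_ge0 (a x : R) : 0 <= gamma_pdf a x.
Proof.
rewrite /gamma_pdf divr_ge0 ?mulr_ge0 ?powR_ge0 ?expR_ge0// /gammaF.
by apply: fine_ge0; apply: integral_ge0 => y _; rewrite lee_fin mulr_ge0 ?powR_ge0 ?expR_ge0.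
Qed.

Lemma measurable_gamma_kernel (a : R) :
  measurable_fun setT (fun x : R => x `^ (a - 1) * expR (- x)).
Proof.
apply: measurable_funM; first exact: measurable_powR.
by apply: (measurableT_comp (@measurable_expR R)); exact: measurable_funN.
Qed.

Lemma measurable_gamma_pdf (a : R) : measurable_fun setT (gamma_pdf a).
Proof.
by apply: measurable_funM; [exact: measurable_gamma_kernel|exact: measurable_cst].
Qed.

Lemma gammaF1 : gammaF 1 = 1 :> R.
Proof.
rewrite /gammaF (_ : (\int[_]_(_ in _) _)%E = 1%E)//.
rewrite -[RHS](@gamma_integral_nat R 0)//; apply: eq_integral => x _.
by rewrite subrr powRr0 expr0.
Qed.

Lemma gamma_pdf1 (x : R) : gamma_pdf 1 x = expR (- x).
Proof. by rewrite /gamma_pdf gammaF1 divr1 subrr powRr0 mul1r. Qed.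

(** The Laplace transform of a Gamma law, by the substitution of (1 + t) x for x. *)
Lemma gamma_pdf_laplace (a t : R) : gammaF a != 0 -> 0 <= t ->
  (\int[mu]_(x in pos) (gamma_pdf a x * expR (- (t * x)))%:E
   = ((1 + t) `^ (- a))%:E)%E.
Proof.
move=> a0 t0; have c0 : 0 < 1 + t by lra.
(* [fine] sends infinite values to 0, so a nonzero [gammaF a] certifies that the integral is
   finite. *)
have GE : (\int[mu]_(x in pos) (x `^ (a - 1) * expR (- x))%:E = (gammaF a)%:E)%E.
  rewrite /gammaF fineK//; move: a0; rewrite /gammaF.
  by case: (\int[_]_(_ in _) _)%E => //=; rewrite eqxx.
transitivity (\int[mu]_(x in pos) (((1 + t) `^ (1 - a) / gammaF a)%:E
  * (((1 + t) * x) `^ (a - 1) * expR (- ((1 + t) * x)))%:E))%E.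
  apply: eq_integral => x /set_mem x0; rewrite -EFinM; congr EFin.
  rewrite powRM ?(ltW c0) ?(ltW x0)// /gamma_pdf.
  have -> : expR (- ((1 + t) * x)) = expR (- x) * expR (- (t * x)).
    by rewrite -expRD; congr expR; ring.
  have E : (1 + t) `^ (1 - a) * (1 + t) `^ (a - 1) = 1.
    rewrite -powRD; last by rewrite (gt_eqF c0) implybT.
    have -> : 1 - a + (a - 1) = 0 by ring.
    exact: powRr0.
  rewrite -[LHS]mulr1 -[X in _ * X = _]E; field; exact: a0.
rewrite ge0_integralZl//; last 4 first.
- exact: measurable_posR.
- apply/measurable_EFinP; apply: measurable_funTS.
  apply: (measurableT_comp (measurable_gamma_kernel a)); exact: mulrl_measurable.
- by move=> x _; rewrite lee_fin mulr_ge0 ?expR_ge0 ?powR_ge0.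
- rewrite lee_fin divr_ge0 ?powR_ge0//; apply: fine_ge0.
  by apply: integral_ge0 => y _; rewrite lee_fin mulr_ge0 ?powR_ge0 ?expR_ge0.
rewrite (integral_scale c0 (measurable_gamma_kernel a)); last first.
  by move=> x; rewrite mulr_ge0 ?expR_ge0 ?powR_ge0.
rewrite GE -!EFinM; congr EFin.
have -> : (1 + t) `^ (- a) = (1 + t) `^ (1 - a) / (1 + t).
  rewrite -[X in _ / X]powRr1 -?powRB ?(ltW c0) ?(gt_eqF c0) ?implybT//.
  by congr (_ `^ _); ring.
by field; rewrite a0 gt_eqF.
Qed.

Lemma gamma_pdf_total (a : R) : gammaF a != 0 ->
  (\int[mu]_(x in pos) (gamma_pdf a x)%:E = 1)%E.
Proof.
move=> a0; have := gamma_pdf_laplace a0 (lexx 0).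
rewrite addr0 powR1 => <-; apply: eq_integral => x _.
by rewrite mul0r oppr0 expR0 mulr1.
Qed.

End GammaIntegrals.

(** * Gamma expectations *)

Section GammaExpectation.
Context (R : realType).
Notation mu := (@lebesgue_measure R).
Notation pos := (@posR R).
Implicit Types (al : seq R) (ms : seq nat) (g : seq R).

Definition all_pos g : Prop := forall x, x \in g -> 0 < x.

Lemma all_pos_cons x g : 0 < x -> all_pos g -> all_pos (x :: g).
Proof. by move=> x0 g0 y; rewrite in_cons => /orP[/eqP ->|/g0]. Qed.

Lemma gamma_expect_ge0 al (F : seq R -> \bar R) :
  (forall g, size g = size al -> all_pos g -> 0 <= F g)%E ->
  (0 <= gamma_expect al F)%E.
Proof.
elim: al F => [|a al IH] F F0 /=; first exact: F0.
apply: integral_ge0 => y y0; rewrite mule_ge0 ?lee_fin ?gamma_pdf_ge0//.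
by apply: IH => g sg g0; apply: F0; [rewrite /= sg|exact: all_pos_cons].
Qed.

Lemma le_gamma_expect al (F G : seq R -> \bar R) :
  (forall g, size g = size al -> all_pos g -> 0 <= F g <= G g)%E ->
  (gamma_expect al F <= gamma_expect al G)%E.
Proof.
elim: al F G => [|a al IH] F G FG /=.
  by have /andP[] := FG [::] erefl (fun _ => ltac:(by [])).
apply: ge0_le_integral_nonmeas => y y0; apply/andP; split.
  rewrite mule_ge0 ?lee_fin ?gamma_pdf_ge0//; apply: gamma_expect_ge0 => g sg g0.
  by have /andP[] : (0 <= F (y :: g) <= G (y :: g))%E by apply: FG; [rewrite /= sg|exact: all_pos_cons].
apply: lee_wpmul2l; first by rewrite lee_fin gamma_pdf_ge0.
by apply: IH => g sg g0; apply: FG; [rewrite /= sg|exact: all_pos_cons].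
Qed.

Lemma eq_gamma_expect al (F G : seq R -> \bar R) :
  (forall g, size g = size al -> all_pos g -> F g = G g) ->
  gamma_expect al F = gamma_expect al G.
Proof.
elim: al F G => [|a al IH] F G FG /=; first by apply: FG.
apply: eq_integral => y /set_mem y0; congr (_ * _)%E.
by apply: IH => g sg g0; apply: FG; [rewrite /= sg|exact: all_pos_cons].
Qed.

Lemma measurable_EFin_gamma_pdf a : measurable_fun setT (fun x : R => (gamma_pdf a x)%:E).
Proof. by apply/measurable_EFinP; exact: measurable_gamma_pdf. Qed.

Lemma gamma_expect_cst al (c : R) : 0 <= c -> (forall a, a \in al -> gammaF a != 0) ->
  gamma_expect al (fun=> c%:E) = c%:E.
Proof.
move=> c0; elim: al => [//|a al IH] h /=.
rewrite IH; last by move=> b bs; apply: h; rewrite in_cons bs orbT.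
under eq_integral do rewrite muleC.
rewrite ge0_integralZl//; last 3 first.
- exact: measurable_posR.
- by apply: measurable_funTS; exact: measurable_EFin_gamma_pdf.
- by move=> x _; rewrite lee_fin gamma_pdf_ge0.
by rewrite gamma_pdf_total ?mule1// h// in_cons eqxx.
Qed.

(** Division by zero yields zero, so the density of parameter [a] vanishes identically. *)
Lemma gamma_expect_degenerate al a (F : seq R -> \bar R) :
  a \in al -> gammaF a = 0 -> gamma_expect al F = 0%E.
Proof.
move=> + a0; elim: al F => [//|b al IH] F; rewrite in_cons => /orP[/eqP <-|h] /=.
  by apply: integral0_eq => y _; rewrite /gamma_pdf a0 invr0 mulr0 mul0e.
by apply: integral0_eq => y _; rewrite IH// mule0.
Qed.

(** The absolute value is invisible for [y > 0] and keeps the factor nonnegative on the whole line,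
    as Tonelli's theorem wants. *)
Definition lap_factor (m : nat) (y t : R) : R := `|y| ^+ m * expR (- (t * y)).

(** The mean of g^m exp(- t g) for g of density [gamma_pdf a]. *)
Definition lap_moment (a : R) (m : nat) (t : R) : \bar R :=
  (\int[mu]_(y in pos) (gamma_pdf a y * lap_factor m y t)%:E)%E.

Fixpoint lap_prod ms g (t : R) : R :=
  match ms, g with
  | m :: ms', y :: g' => lap_factor m y t * lap_prod ms' g' t
  | _, _ => 1
  end.

Fixpoint lap_moment_prod al ms (t : R) : \bar R :=
  match al, ms with
  | a :: as', m :: ms' => (lap_moment a m t * lap_moment_prod as' ms' t)%E
  | _, _ => 1%E
  end.

Lemma lap_factor_ge0 m y t : 0 <= lap_factor m y t.
Proof. by rewrite mulr_ge0 ?expR_ge0. Qed.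

Lemma measurable_lap_factor m :
  measurable_fun setT (fun p : R * R => lap_factor m p.1 p.2).
Proof.
apply: measurable_funM.
  by apply: measurable_funX; apply: (measurableT_comp (@normr_measurable R setT)).
apply: (measurableT_comp (@measurable_expR R)); apply: measurable_funN.
by apply: measurable_funM.
Qed.

Lemma lap_moment_ge0 a m t : (0 <= lap_moment a m t)%E.
Proof.
by apply: integral_ge0 => y _; rewrite lee_fin mulr_ge0 ?gamma_pdf_ge0 ?lap_factor_ge0.
Qed.

Lemma measurable_lap_moment a m : measurable_fun setT (lap_moment a m).
Proof.
apply: (@measurable_half_line_integral _ (fun p : R * R =>
  (gamma_pdf a p.2 * lap_factor m p.2 p.1)%:E)).
  apply/measurable_EFinP; apply: measurable_funM.
    by apply: (measurableT_comp (measurable_gamma_pdf a)).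
  exact: (measurableT_comp (measurable_lap_factor m) (measurable_fun_pair _ _)).
by move=> p; rewrite lee_fin mulr_ge0 ?gamma_pdf_ge0 ?lap_factor_ge0.
Qed.

Lemma lap_moment_prod_ge0 al ms t : (0 <= lap_moment_prod al ms t)%E.
Proof.
elim: al ms => [|a al IH] [|m ms] //=; by rewrite mule_ge0 ?lap_moment_ge0.
Qed.

Lemma measurable_lap_moment_prod al ms : measurable_fun setT (lap_moment_prod al ms).
Proof.
elim: al ms => [|a al IH] [|m ms] //=.
by apply: emeasurable_funM => //; exact: measurable_lap_moment.
Qed.

(** One coordinate is integrated out by exchanging it with the Laplace variable [t]; [c] holds the
    factors already fixed and [M] the moments of the later coordinates. *)
Lemma laplace_step a m (c M : R -> \bar R) :
  measurable_fun setT c -> (forall t, 0 <= c t)%E ->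
  measurable_fun setT M -> (forall t, 0 <= M t)%E ->
  (\int[mu]_(y in pos) ((gamma_pdf a y)%:E *
     \int[mu]_(t in pos) (c t * (lap_factor m y t)%:E * M t))
   = \int[mu]_(t in pos) (c t * (lap_moment a m t * M t)))%E.
Proof.
move=> mc c0 mM M0.
pose f (p : R * R) : \bar R := ((gamma_pdf a p.1)%:E
  * (c p.2 * (lap_factor m p.1 p.2)%:E * M p.2))%E.
have f0 p : (0 <= f p)%E.
  by rewrite /f !mule_ge0// lee_fin ?gamma_pdf_ge0 ?lap_factor_ge0.
have mlf : measurable_fun setT (fun p : R * R => (lap_factor m p.1 p.2)%:E).
  by apply/measurable_EFinP; exact: measurable_lap_factor.
have mpdf : measurable_fun setT (fun p : R * R => (gamma_pdf a p.1)%:E).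
  by apply: (measurableT_comp (measurable_EFin_gamma_pdf a)).
have mc2 : measurable_fun setT (fun p : R * R => c p.2) by exact: measurableT_comp.
have mM2 : measurable_fun setT (fun p : R * R => M p.2) by exact: measurableT_comp.
have mf : measurable_fun setT f.
  apply: emeasurable_funM => //; apply: emeasurable_funM => //.
  exact: emeasurable_funM.
transitivity (\int[mu]_(y in pos) \int[mu]_(t in pos) f (y, t))%E.
  apply: eq_integral => y _; rewrite /f /= ge0_integralZl//.
  - exact: measurable_posR.
  - apply: measurable_funTS; apply: emeasurable_funM => //; apply: emeasurable_funM => //.
    exact: (measurable_fun_pair2 y mlf).
  - by move=> t _; rewrite !mule_ge0// lee_fin lap_factor_ge0.
  - by rewrite lee_fin gamma_pdf_ge0.
rewrite half_line_swap//; apply: eq_integral => t _.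
transitivity (\int[mu]_(y in pos) (c t * M t * (gamma_pdf a y * lap_factor m y t)%:E))%E.
  apply: eq_integral => y _; rewrite /f /= EFinM.
  rewrite -(muleA (c t)) muleCA (muleA (gamma_pdf a y)%:E).
  by rewrite muleC EFinM.
rewrite ge0_integralZl//.
- by rewrite -muleA; congr (_ * _)%E; rewrite muleC.
- exact: measurable_posR.
- apply: measurable_funTS; apply/measurable_EFinP; apply: measurable_funM.
    exact: measurable_gamma_pdf.
  exact: (measurable_fun_pair1 t (measurable_lap_factor m)).
- by move=> y _; rewrite lee_fin mulr_ge0 ?gamma_pdf_ge0 ?lap_factor_ge0.
- by rewrite mule_ge0.
Qed.

Lemma measurable_lap_weight m y (c : R -> \bar R) : measurable_fun setT c ->
  measurable_fun setT (fun t => c t * (lap_factor m y t)%:E)%E.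
Proof.
move=> mc; apply: emeasurable_funM => //; apply/measurable_EFinP.
exact: (measurable_fun_pair2 y (measurable_lap_factor m)).
Qed.

(** At fixed [t] the integrand is a product over the coordinates, so the mean factorises. The
    general weight [c] lets the induction absorb the factor of the first coordinate. *)
Lemma gamma_expect_laplace al ms (c : R -> \bar R) : size ms = size al ->
  measurable_fun setT c -> (forall t, 0 <= c t)%E ->
  gamma_expect al (fun g => \int[mu]_(t in pos) (c t * (lap_prod ms g t)%:E))%E
  = (\int[mu]_(t in pos) (c t * lap_moment_prod al ms t))%E.
Proof.
elim: al ms c => [|a al IH] [|m ms] c //= [sz] mc c0.
rewrite -laplace_step//; last 2 first.
- exact: measurable_lap_moment_prod.
- by move=> t; exact: lap_moment_prod_ge0.
apply: eq_integral => y _; congr (_ * _)%E.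
rewrite -IH//; last 2 first.
- exact: measurable_lap_weight.
- by move=> t; rewrite mule_ge0// lee_fin lap_factor_ge0.
apply: eq_gamma_expect => g _ _; apply: eq_integral => t _.
by rewrite EFinM muleA.
Qed.

End GammaExpectation.

(** * Gamma expectations as a linear functional *)

Section GammaMean.
Context (R : realType).
Notation mu := (@lebesgue_measure R).
Notation pos := (@posR R).
Implicit Types (al g : seq R) (ms : seq nat).

(* A relation rather than an operator, so that it carries the integrability that
   linearity needs. *)
Fixpoint gamma_mean al (f : seq R -> R) (v : R) : Prop :=
  match al with
  | [::] => f [::] = v
  | a :: al' => exists v' : R -> R,
     [/\ forall y, 0 < y -> gamma_mean al' (fun g => f (y :: g)) (v' y),
         measurable_fun pos v',
         exists B, forall y, 0 < y -> `|v' y| <= B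
       & (\int[mu]_(y in pos) (gamma_pdf a y * v' y)%:E = v%:E)%E]
  end.

Lemma gamma_mean_expect al f v : gamma_mean al f v ->
  gamma_expect al (fun g => (f g)%:E) = v%:E.
Proof.
elim: al f v => [|a al IH] f v /=; first by move=> ->.
move=> [v' [fv' _ _ <-]]; apply: eq_integral => y /set_mem y0.
by rewrite (IH _ _ (fv' y y0)) EFinM.
Qed.

Lemma integrable_gamma_pdfM a (v : R -> R) : gammaF a != 0 ->
  measurable_fun pos v -> (exists B, forall y, 0 < y -> `|v y| <= B) ->
  mu.-integrable pos (EFin \o (fun y => gamma_pdf a y * v y)).
Proof.
move=> a0 mv [B vB].
have mp : measurable_fun pos (gamma_pdf a).
  by apply: measurable_funTS; exact: measurable_gamma_pdf.
have ip : mu.-integrable pos (EFin \o gamma_pdf a).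
  apply/integrableP; split; first exact/measurable_EFinP.
  rewrite (_ : (\int[_]_(_ in _) _)%E = 1%E) ?ltry//.
  rewrite -(gamma_pdf_total a0); apply: eq_integral => y _.
  by rewrite /= ger0_norm ?gamma_pdf_ge0.
have iB : mu.-integrable pos (fun x => B%:E * (EFin \o gamma_pdf a) x)%E.
  by apply: integrableZl => //; exact: measurable_posR.
apply: (le_integrable _ _ _ iB); first exact: measurable_posR.
  by apply/measurable_EFinP; exact: measurable_funM.
move=> y y0 /=; rewrite lee_fin normrM [leRHS]normrM mulrC ler_wpM2r//.
by rewrite (le_trans (vB y y0))// ler_norm.
Qed.

Lemma gamma_mean_cst al (c : R) : (forall a, a \in al -> gammaF a != 0) ->
  gamma_mean al (fun=> c) c.
Proof.
elim: al => [//|a al IH] h /=; exists (fun=> c).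
have a0 : gammaF a != 0 by apply: h; rewrite in_cons eqxx.
split; first by move=> _ _; apply: IH => b bs; apply: h; rewrite in_cons bs orbT.
- exact: measurable_cst.
- by exists `|c|.
- under eq_integral do rewrite mulrC EFinM.
  rewrite integralZl//; last 2 first.
  + exact: measurable_posR.
  + have := @integrable_gamma_pdfM a (fun=> 1) a0 (measurable_cst _).
    rewrite (_ : (fun y => _ * 1) = gamma_pdf a); last by apply/funext => y; rewrite mulr1.
    by apply; exists 1 => y _; rewrite normr1.
  by rewrite gamma_pdf_total// mule1.
Qed.

Lemma gamma_meanD al f f' v v' : (forall a, a \in al -> gammaF a != 0) ->
  gamma_mean al f v -> gamma_mean al f' v' ->
  gamma_mean al (fun g => f g + f' g) (v + v').
Proof.
elim: al f f' v v' => [|a al IH] f f' v v' h /=; first by move=> -> ->.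
have a0 : gammaF a != 0 by apply: h; rewrite in_cons eqxx.
move=> [u [fu mu_ [B uB] uv]] [u' [fu' mu' [B' uB'] uv']].
exists (fun y => u y + u' y); split.
- move=> y y0; apply: IH; [|exact: fu|exact: fu'].
  by move=> b bs; apply: h; rewrite in_cons bs orbT.
- exact: measurable_funD.
- by exists (B + B') => y y0; rewrite (le_trans (ler_normD _ _))// lerD ?uB ?uB'.
- under eq_integral do rewrite mulrDr EFinD.
  rewrite integralD//=; last 3 first.
  + exact: measurable_posR.
  + by apply: integrable_gamma_pdfM => //; exists B.
  + by apply: integrable_gamma_pdfM => //; exists B'.
  by rewrite uv uv'.
Qed.

Lemma gamma_meanZ al f v c : (forall a, a \in al -> gammaF a != 0) ->
  gamma_mean al f v -> gamma_mean al (fun g => c * f g) (c * v).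
Proof.
elim: al f v => [|a al IH] f v h /=; first by move=> ->.
have a0 : gammaF a != 0 by apply: h; rewrite in_cons eqxx.
move=> [u [fu mu_ [B uB] uv]].
exists (fun y => c * u y); split.
- move=> y y0; apply: IH; last exact: fu.
  by move=> b bs; apply: h; rewrite in_cons bs orbT.
- exact: measurable_funM.
- by exists (`|c| * B) => y y0; rewrite normrM ler_wpM2l ?uB.
- under eq_integral do rewrite mulrCA EFinM.
  rewrite integralZl//; last 2 first.
  + exact: measurable_posR.
  + by apply: integrable_gamma_pdfM => //; exists B.
  by rewrite uv.
Qed.

Lemma gamma_mean_sum al (I : Type) (s : seq I) (f : I -> seq R -> R) (v : I -> R) :
  (forall a, a \in al -> gammaF a != 0) ->
  (forall i, gamma_mean al (f i) (v i)) ->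
  gamma_mean al (fun g => \sum_(i <- s) f i g) (\sum_(i <- s) v i).
Proof.
move=> h fv; elim: s => [|i s IH].
  rewrite big_nil (_ : (fun g => _) = fun=> 0); first exact: gamma_mean_cst.
  by apply/funext => g; rewrite big_nil.
rewrite big_cons (_ : (fun g => _) = fun g => f i g + \sum_(j <- s) f j g).
  exact: gamma_meanD.
by apply/funext => g; rewrite big_cons.
Qed.

(** The partial means that [gamma_mean] asks for are again Laplace integrals, hence measurable in
    the fixed coordinate; the bounds on [f] make them finite. *)
Lemma gamma_mean_laplace al ms (c : R -> \bar R) f v B :
  size ms = size al -> (forall a, a \in al -> gammaF a != 0) ->
  measurable_fun setT c -> (forall t, 0 <= c t)%E ->
  (forall g, size g = size al -> all_pos g ->
     (f g)%:E = (\int[mu]_(t in pos) (c t * (lap_prod ms g t)%:E))%E) ->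
  (forall g, size g = size al -> all_pos g -> 0 <= f g <= B) ->
  (\int[mu]_(t in pos) (c t * lap_moment_prod al ms t) = v%:E)%E ->
  gamma_mean al f v.
Proof.
elim: al ms c f v => [|a al IH] [|m ms] c f v //= sz h mc c0 fE fB vE.
  have := fE [::] erefl; rewrite vE => E.
  by have [] : (f [::])%:E = v%:E by apply: E => x; rewrite in_nil.
case: sz => sz.
pose c' y t := (c t * (lap_factor m y t)%:E)%E.
have mc' y : measurable_fun setT (c' y) by exact: measurable_lap_weight.
have c'0 y t : (0 <= c' y t)%E by rewrite mule_ge0// lee_fin lap_factor_ge0.
have h' b : b \in al -> gammaF b != 0 by move=> bs; apply: h; rewrite in_cons bs orbT.
(* The bounds on [f] are read at the point whose coordinates are all 1. *)
have B0 : 0 <= B.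
  have p1 : all_pos (1 :: [seq (1 : R) | _ <- al]).
    by move=> x; rewrite in_cons => /orP[/eqP ->//|/mapP[_ _ ->]].
  have s1 : size (1 :: [seq (1 : R) | _ <- al]) = (size al).+1 by rewrite /= size_map.
  by have /andP[h1] := fB _ s1 p1; exact: le_trans.
(* The partial mean at first coordinate [y], extended-real until its finiteness is known. *)
pose K y := (\int[mu]_(t in pos) (c' y t * lap_moment_prod al ms t))%E.
have fE' y : 0 < y -> forall g, size g = size al -> all_pos g ->
    (f (y :: g))%:E = (\int[mu]_(t in pos) (c' y t * (lap_prod ms g t)%:E))%E.
  move=> y0 g sg g0; rewrite fE; [|by rewrite /= sg|exact: all_pos_cons].
  by apply: eq_integral => t _; rewrite /= EFinM muleA.
have KE : forall y, 0 < y -> K y = gamma_expect al (fun g => (f (y :: g))%:E).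
  move=> y y0; rewrite /K -gamma_expect_laplace//.
  by apply: eq_gamma_expect => g sg g0; rewrite fE'.
have fB' y : 0 < y -> forall g, size g = size al -> all_pos g -> 0 <= f (y :: g) <= B.
  by move=> y0 g sg g0; apply: fB; [rewrite /= sg|exact: all_pos_cons].
have IB y : 0 < y -> (0 <= K y <= B%:E)%E.
  move=> y0; rewrite KE//; apply/andP; split.
    by apply: gamma_expect_ge0 => g sg g0; have /andP[] := fB' y y0 g sg g0.
  rewrite -(gamma_expect_cst B0 h'); apply: le_gamma_expect => g sg g0.
  by rewrite !lee_fin fB'.
have Ifin y : 0 < y -> (fine (K y))%:E = K y.
  move=> /IB/andP[I0 I1]; rewrite fineK// ge0_fin_numE//.
  by rewrite (le_lt_trans I1)// ltry.
exists (fun y => fine (K y)); split.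
- by move=> y y0; apply: (IH ms (c' y)) => //; [exact: fE'|exact: fB'|rewrite Ifin].
- apply: (@measurableT_comp _ _ _ _ _ _ fine _ K); first exact: fine_measurable.
  apply: measurable_funTS.
  apply: (@measurable_half_line_integral _ (fun p : R * R => c' p.1 p.2 * lap_moment_prod al ms p.2)%E).
    apply: emeasurable_funM.
      apply: emeasurable_funM; first exact: measurableT_comp.
      by apply/measurable_EFinP; exact: measurable_lap_factor.
    by apply: measurableT_comp => //; exact: measurable_lap_moment_prod.
  by move=> p; rewrite mule_ge0// lap_moment_prod_ge0.
- exists B => y y0; have := IB y y0; rewrite -Ifin// !lee_fin => /andP[I0 I1].
  by rewrite ger0_norm.
- rewrite -vE -laplace_step//; last 2 first.
  + exact: measurable_lap_moment_prod.
  + by move=> t; exact: lap_moment_prod_ge0.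
  by apply: eq_integral => y /set_mem y0; rewrite EFinM Ifin.
Qed.

End GammaMean.

(** * Moments of the Dirichlet weights *)

Section DirichletMoments.
Context (R : realType).
Notation mu := (@lebesgue_measure R).
Notation pos := (@posR R).
Implicit Types (g : seq R) (ms : seq nat).

Definition monom ms g : R := \prod_(j < size g) nth 0 g j ^+ nth 0%N ms j.

Lemma monom_cons m ms x g : monom (m :: ms) (x :: g) = x ^+ m * monom ms g.
Proof. by rewrite /monom big_ord_recl. Qed.

Lemma lap_prodE ms g t : size ms = size g -> all_pos g ->
  lap_prod ms g t = monom ms g * expR (- (t * \sum_(x <- g) x)).
Proof.
elim: ms g => [|m ms IH] [|x g] //= sz g0.
  by rewrite /monom big_ord0 big_nil mulr0 oppr0 expR0 mulr1.
have x0 : 0 < x by apply: g0; rewrite in_cons eqxx.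
rewrite IH; [|by case: sz|by move=> y yg; apply: g0; rewrite in_cons yg orbT].
rewrite big_cons monom_cons /lap_factor gtr0_norm// mulrDr opprD expRD.
ring.
Qed.

(** With [s] the sum of [g], this places monomials in the normalised weights between 0 and 1. *)
Lemma monom_bounds (s : R) ms g : size ms = size g ->
  (forall x, x \in g -> 0 < x <= s) -> 0 <= monom ms g <= s ^+ sumn ms.
Proof.
elim: ms g => [|m ms IH] [|x g] //= sz gs.
  by rewrite /monom big_ord0 ler01 lexx.
have /andP[x0 xs] : 0 < x <= s by apply: gs; rewrite in_cons eqxx.
have /andP[h0 h1] : 0 <= monom ms g <= s ^+ sumn ms.
  by apply: IH; [case: sz|move=> y yg; apply: gs; rewrite in_cons yg orbT].
rewrite monom_cons mulr_ge0 ?exprn_ge0 ?(ltW x0)//= exprD.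
by rewrite ler_pM ?exprn_ge0 ?(ltW x0)// lerXn2r ?nnegrE ?(ltW x0)// (le_trans (ltW x0)).
Qed.

Lemma lap_moment1 m t : (m <= 2)%N -> 0 < t ->
  lap_moment 1 m t = (m`!%:R / (1 + t) ^+ m.+1 : R)%:E.
Proof.
move=> m2 t0; have c0 : 0 < 1 + t by lra.
rewrite -gamma_integral_rate//; apply: eq_integral => y /set_mem y0.
rewrite gamma_pdf1 /lap_factor gtr0_norm// mulrDl mul1r opprD expRD.
by congr EFin; ring.
Qed.

Lemma lap_moment0 (a t : R) : gammaF a != 0 -> 0 < t ->
  lap_moment a 0 t = ((1 + t) `^ (- a))%:E.
Proof.
move=> a0 t0; rewrite -gamma_pdf_laplace ?(ltW t0)//.
by apply: eq_integral => y _; rewrite /lap_factor expr0 mul1r.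
Qed.

Lemma lap_moment_prod_nseq0 T (a t : R) : gammaF a != 0 -> 0 < t ->
  lap_moment_prod (nseq T a) (nseq T 0%N) t = ((1 + t) `^ (- (T%:R * a)))%:E.
Proof.
move=> a0 t0; elim: T => [|T IH] /=; first by rewrite mul0r oppr0 powRr0.
have c0 : 0 < 1 + t by lra.
rewrite IH lap_moment0// -EFinM -powRD; last by rewrite (gt_eqF c0) implybT.
by congr (_ `^ _)%:E; rewrite -natr1; ring.
Qed.

(** Each parameter 1 with exponent m contributes m! / (1 + t)^(m+1), whence the total exponent. *)
Lemma lap_moment_prod_cat ms1 ms2 al t : all (fun m => m <= 2)%N ms1 -> 0 < t ->
  lap_moment_prod (nseq (size ms1) 1 ++ al) (ms1 ++ ms2) t =
  (((\prod_(m <- ms1) m`!%:R) / (1 + t) ^+ (size ms1 + sumn ms1) : R)%:E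
    * lap_moment_prod al ms2 t)%E.
Proof.
move=> + t0; elim: ms1 => [|m ms1 IH] /=.
  by rewrite big_nil expr0 divr1 mul1e.
move=> /andP[m2 /IH ->]; rewrite lap_moment1// muleA -EFinM; congr (_%:E * _)%E.
have -> : ((size ms1).+1 + (m + sumn ms1) = m.+1 + (size ms1 + sumn ms1))%N.
  by rewrite !addSn addnCA.
by rewrite big_cons (exprD _ m.+1) (invfM (_ ^+ m.+1)) [RHS]mulrACA.
Qed.

Variables (n T : nat) (alpha : R).
Hypotheses (alpha0 : 0 < alpha) (T0 : (0 < T)%N).
Let a := alpha / T%:R.
Hypothesis a0 : gammaF a != 0.
Let al : seq R := nseq n 1 ++ nseq T a.
Let A : R := n%:R + alpha.

Lemma dirichlet_params_nondegenerate b : b \in al -> gammaF b != 0.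
Proof.
rewrite mem_cat => /orP[/nseqP[-> _]|/nseqP[-> _]//].
by rewrite gammaF1 oner_eq0.
Qed.

Lemma dirichlet_total_gt0 : 0 < A.
Proof. by rewrite /A ltr_wpDl. Qed.

Lemma size_dirichlet_params : size al = (n + T)%N.
Proof. by rewrite size_cat !size_nseq. Qed.

Lemma sum_pos_gt0 g : size g = size al -> all_pos g -> 0 < \sum_(x <- g) x.
Proof.
rewrite size_dirichlet_params; case: g => [|x g] /=; first by move/esym/eqP; rewrite addn_eq0 [T == 0%N]eqn0Ngt T0 andbF.
move=> _ g0; rewrite big_cons ltr_wpDr ?g0 ?in_cons ?eqxx//.
rewrite big_seq; apply: sumr_ge0 => y yg; rewrite ltW// g0//.
by rewrite in_cons yg orbT.
Qed.

Lemma mem_le_sum g x : all_pos g -> x \in g -> x <= \sum_(y <- g) y.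
Proof.
elim: g => [//|y g IH] g0; rewrite big_cons in_cons => /orP[/eqP ->|xg].
  rewrite lerDl big_seq; apply: sumr_ge0 => z zg; rewrite ltW// g0//.
  by rewrite in_cons zg orbT.
have h : all_pos g by move=> z zg; apply: g0; rewrite in_cons zg orbT.
by rewrite (le_trans (IH h xg))// lerDr ltW// g0// in_cons eqxx.
Qed.

(** The degree is p + 1, and 1 / S^(p+1) is the integral of t^p exp(- t S) because p! = 1 for p <=
    1. Up to factorials the Laplace moments then multiply to (1 + t)^-(A + p + 1), and one integral
    in [t] remains. *)
Lemma dirichlet_monom_mean (p : nat) ms : (p <= 1)%N -> size ms = n ->
  all (fun m => m <= 2)%N ms -> sumn ms = p.+1 ->
  gamma_mean al (fun g => monom (ms ++ nseq T 0%N) g / (\sum_(x <- g) x) ^+ p.+1)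
   ((\prod_(m <- ms) m`!%:R) * (if p is 0 then A^-1 else (A * (A + 1))^-1)).
Proof.
move=> p1 szm m2 sm.
have A0 := dirichlet_total_gt0.
have szs : size (ms ++ nseq T 0%N) = size al.
  by rewrite size_cat szm size_dirichlet_params size_nseq.
apply: (@gamma_mean_laplace _ _ (ms ++ nseq T 0%N) (fun t => (`|t| ^+ p)%:E) _ _ 1) => //.
- exact: dirichlet_params_nondegenerate.
- by apply/measurable_EFinP; apply: measurable_funX; exact: normr_measurable.
- move=> g sg g0; have S0 := sum_pos_gt0 sg g0.
  transitivity (\int[mu]_(t in pos) ((monom (ms ++ nseq T 0%N) g)%:E
      * (t ^+ p * expR (- ((\sum_(x <- g) x) * t)))%:E))%E; last first.
    apply: eq_integral => t /set_mem t0; rewrite lap_prodE ?szs ?sg// -!EFinM.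
    by rewrite gtr0_norm// [_ * t]mulrC; congr EFin; ring.
  have /andP[M0 _] := @monom_bounds (\sum_(x <- g) x) (ms ++ nseq T 0%N) g
    (etrans szs (esym sg)) (fun x xg => introT andP (conj (g0 x xg) (mem_le_sum g0 xg))).
  rewrite ge0_integralZl//; last 3 first.
  + exact: measurable_posR.
  + apply/measurable_EFinP; apply: measurable_funTS; apply: measurable_funM.
      exact: measurable_funX.
    apply: (measurableT_comp (@measurable_expR R)); apply: measurable_funN.
    exact: mulrl_measurable.
  + by move=> t t0; rewrite lee_fin mulr_ge0 ?expR_ge0 ?exprn_ge0 ?(ltW t0).
  rewrite gamma_integral_rate ?(leq_trans p1)// -EFinM.
  by case: (p) p1 => [|[|//]] _; rewrite mul1r.
- move=> g sg g0; have S0 := sum_pos_gt0 sg g0.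
  have /andP[M0] := @monom_bounds (\sum_(x <- g) x) (ms ++ nseq T 0%N) g
    (etrans szs (esym sg)) (fun x xg => introT andP (conj (g0 x xg) (mem_le_sum g0 xg))).
  rewrite sumn_cat sm sumn_nseq mul0n addn0 => M1.
  by rewrite divr_ge0 ?exprn_ge0 ?(ltW S0)//= ler_pdivrMr ?exprn_gt0// mul1r.
- transitivity (\int[mu]_(t in pos) ((\prod_(m <- ms) m`!%:R)%:E
      * (t ^+ p * (1 + t) `^ (- (A + p.+1%:R)))%:E))%E.
    apply: eq_integral => t /set_mem t0.
    have c0 : 0 < 1 + t by rewrite addr_gt0.
    rewrite /al -{1}szm lap_moment_prod_cat// lap_moment_prod_nseq0//.
    rewrite -!EFinM gtr0_norm//; congr EFin.
    rewrite szm sm -powR_invn ?(ltW c0)//.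
    have -> : T%:R * a = alpha by rewrite /a mulrC divfK// pnatr_eq0 -lt0n.
    have -> : - (A + p.+1%:R) = - (n + p.+1)%:R + - alpha.
      by rewrite natrD /A; ring.
    rewrite powRD; last by rewrite (gt_eqF c0) implybT.
    ring.
  rewrite ge0_integralZl//; last 4 first.
  + exact: measurable_posR.
  + apply/measurable_EFinP; apply: measurable_funTS; apply: measurable_funM.
      exact: measurable_funX.
    by apply: (measurableT_comp (@measurable_powR R _)); exact: measurable_funD.
  + by move=> t t0; rewrite lee_fin mulr_ge0 ?powR_ge0 ?exprn_ge0 ?(ltW t0).
  + by rewrite lee_fin prodr_ge0.
  rewrite EFinM; congr (_ * _)%E; case: (p) p1 => [|[|//]] _.
    rewrite -integral_powR1D//; apply: eq_integral => t _.
    by rewrite expr0 mul1r.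
  by rewrite -integral_id_powR1D//; apply: eq_integral => t _; rewrite expr1.
Qed.

End DirichletMoments.

(** * First and second moments of the normalised weights *)

Section DirichletWeights.
Context (R : realType).
Implicit Types (g : seq R) (ms : seq nat).

Lemma eq_gamma_mean (al : seq R) f f' v :
  (forall g, size g = size al -> all_pos g -> f g = f' g) ->
  gamma_mean al f v -> gamma_mean al f' v.
Proof.
elim: al f f' v => [|a al IH] f f' v ff' /=; first by rewrite -ff'.
move=> [u [fu mu_ uB uv]]; exists u; split => // y y0; apply: IH (fu y y0).
by move=> g sg g0; apply: ff'; [rewrite /= sg|exact: all_pos_cons].
Qed.

Lemma prod_expr_delta N (x : nat -> R) i : (i < N)%N ->
  \prod_(j < N) x j ^+ (j == i :> nat) = x i.
Proof.
move=> iN; transitivity (\prod_(j < N | j == Ordinal iN) x j); last by rewrite big_pred1_eq.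
by rewrite [RHS]big_mkcond; apply: eq_bigr => j _; rewrite -val_eqE /=; case: eqP.
Qed.

Lemma sum_delta N i : (i < N)%N -> (\sum_(j < N) (j == i :> nat) = 1)%N.
Proof.
move=> iN; transitivity (\sum_(j < N | j == Ordinal iN) 1)%N; last by rewrite big_pred1_eq.
by rewrite [RHS]big_mkcond; apply: eq_bigr => j _; rewrite -val_eqE /=; case: eqP.
Qed.

Lemma nth_mkseq_nseq0 (m : nat -> nat) n T j : (forall i, (n <= i)%N -> m i = 0%N) ->
  nth 0%N (mkseq m n ++ nseq T 0%N) j = m j.
Proof.
move=> m0; rewrite nth_cat size_mkseq; case: ltnP => jn; first by rewrite nth_mkseq.
by rewrite nth_nseq if_same m0.
Qed.

Lemma sumn_mkseq (m : nat -> nat) n : sumn (mkseq m n) = (\sum_(j < n) m j)%N.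
Proof. by rewrite sumnE big_map -(big_mkord xpredT m) /index_iota subn0. Qed.

Lemma prod_fact_mkseq (m : nat -> nat) n :
  \prod_(i <- mkseq m n) i`!%:R = \prod_(j < n) (m j)`!%:R :> R.
Proof. by rewrite big_map -(big_mkord xpredT (fun j => (m j)`!%:R)) /index_iota subn0. Qed.

Variables (n T : nat) (alpha : R).
Hypotheses (alpha0 : 0 < alpha) (T0 : (0 < T)%N).
Let a := alpha / T%:R.
Hypothesis a0 : gammaF a != 0.
Let al : seq R := nseq n 1 ++ nseq T a.
Let A : R := n%:R + alpha.

Local Notation weight g i := (nth 0 g i / \sum_(x <- g) x).

Lemma dirichlet_weight_mean i : (i < n)%N -> gamma_mean al (fun g => weight g i) A^-1.
Proof.
move=> iN; have m0 j : (n <= j)%N -> nat_of_bool (j == i) = 0%N.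
  by move=> nj; rewrite gtn_eqF// (leq_trans iN).
pose ms := mkseq (fun j => nat_of_bool (j == i)) n.
have m2 : all (fun m => m <= 2)%N ms.
  by rewrite all_map; apply/allP => j _ /=; case: eqP.
have sm : sumn ms = 1%N by rewrite sumn_mkseq sum_delta.
have := dirichlet_monom_mean alpha0 T0 a0 (p := 0) isT (size_mkseq _ _) m2 sm.
rewrite prod_fact_mkseq big1 ?mul1r; last by move=> j _; case: eqP.
apply: eq_gamma_mean => g sg g0; rewrite expr1; congr (_ / _).
rewrite /monom; under eq_bigr do rewrite nth_mkseq_nseq0//.
rewrite (prod_expr_delta (nth 0 g))// sg size_dirichlet_params.
by rewrite ltn_addr.
Qed.

(** The exponent vector is a sum of two indicator vectors; its product of factorials is 2 when they
    coincide and 1 otherwise. *)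
Lemma dirichlet_weight_mean2 i j : (i < n)%N -> (j < n)%N ->
  gamma_mean al (fun g => weight g i * weight g j)
    ((1 + (i == j)%:R) / (A * (A + 1))).
Proof.
move=> iN jN; pose m l := ((l == i) + (l == j))%N.
have m0 l : (n <= l)%N -> m l = 0%N.
  by move=> nl; rewrite /m !gtn_eqF// (leq_trans iN, leq_trans jN).
have m2 : all (fun m => m <= 2)%N (mkseq m n).
  by rewrite all_map; apply/allP => l _ /=; rewrite /m; case: eqP; case: eqP.
have sm : sumn (mkseq m n) = 2%N by rewrite sumn_mkseq big_split /= !sum_delta.
have := dirichlet_monom_mean alpha0 T0 a0 (p := 1) isT (size_mkseq _ _) m2 sm.
rewrite prod_fact_mkseq (_ : \prod_(l < n) _ = 1 + (i == j)%:R); last first.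
  have [ij|ij] := eqVneq i j.
    transitivity (\prod_(l < n) (2 : R) ^+ (l == i :> nat)).
      by apply: eq_bigr => l _; rewrite /m -ij; case: eqP.
    by rewrite (prod_expr_delta (fun=> 2))//; ring.
  rewrite big1 ?addr0// => l _; rewrite /m; case: eqP => [->|_]; last by case: eqP.
  by rewrite (negbTE ij).
apply: eq_gamma_mean => g sg g0.
rewrite mulrACA -invfM -expr2; congr (_ / _).
rewrite /monom; under eq_bigr do rewrite nth_mkseq_nseq0// exprD.
rewrite big_split /= !(prod_expr_delta (nth 0 g))// sg size_dirichlet_params.
  by rewrite ltn_addr.
by rewrite ltn_addr.
Qed.

Variable K : 'I_n -> 'I_n -> R.

Lemma dirichlet_quad_mean (c : R) :
  gamma_mean al
    (fun g => \sum_(i < n) \sum_(j < n) (weight g i - c) * (weight g j - c) * K i j)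
    (\sum_(i < n) \sum_(j < n)
      (((1 + (i == j)%:R) / (A * (A + 1)) - 2 * c / A + c ^+ 2) * K i j)).
Proof.
have h := @dirichlet_params_nondegenerate R n T alpha a0.
apply: gamma_mean_sum => // i; apply: gamma_mean_sum => // j.
have -> : (((1 + (i == j)%:R) / (A * (A + 1)) - 2 * c / A + c ^+ 2) * K i j)
  = K i j * ((1 + (i == j)%:R) / (A * (A + 1))) + - c * K i j * A^-1
    + - c * K i j * A^-1 + c ^+ 2 * K i j by ring.
apply: (@eq_gamma_mean _ (fun g => K i j * (weight g i * weight g j)
  + - c * K i j * weight g i + - c * K i j * weight g j + c ^+ 2 * K i j)).
  by move=> g _ _; ring.
apply: gamma_meanD => //; last exact: gamma_mean_cst.
apply: gamma_meanD => //; last by apply: gamma_meanZ => //; exact: dirichlet_weight_mean.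
apply: gamma_meanD => //; last by apply: gamma_meanZ => //; exact: dirichlet_weight_mean.
by apply: gamma_meanZ => //; exact: dirichlet_weight_mean2.
Qed.

(** As the weights sum to one, this is the mean total weight of the pseudo-samples. *)
Lemma dirichlet_rest_mean :
  gamma_mean al (fun g => 1 - \sum_(i < n) weight g i) (1 - n%:R / A).
Proof.
have h := @dirichlet_params_nondegenerate R n T alpha a0.
have -> : 1 - n%:R / A = 1 + - 1 * \sum_(i < n) A^-1.
  by rewrite sumr_const card_ord -mulr_natl; ring.
apply: (@eq_gamma_mean _ (fun g => 1 + - 1 * \sum_(i < n) weight g i)).
  by move=> g _ _; rewrite mulN1r.
apply: gamma_meanD => //; first exact: gamma_mean_cst.
apply: gamma_meanZ => //; apply: gamma_mean_sum => // i.
exact: dirichlet_weight_mean.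
Qed.

End DirichletWeights.

(** * The bound given the data *)

Section PosteriorBound.
Context (R : realType).

(** The left-hand side is the mean found in [dirichlet_quad_mean] at c = 1/n. With b = alpha (alpha
    + 1), and [tr] and [K2] the diagonal and full sums of [K], it equals (tr + (b - N) K2 / N^2) /
    D, where tr <= N and 0 <= K2 <= N^2. The sign of b - N decides which bound on [K2] serves. *)
Lemma weight_covariance_bound n (alpha : R) (K : 'I_n -> 'I_n -> R) :
  (0 < n)%N -> 0 < alpha -> (forall i j, `|K i j| <= 1) ->
  0 <= \sum_(i < n) \sum_(j < n) K i j ->
  \sum_(i < n) \sum_(j < n) (((1 + (i == j)%:R) / ((n%:R + alpha) * (n%:R + alpha + 1))
     - 2 * n%:R^-1 / (n%:R + alpha) + n%:R^-1 ^+ 2) * K i j)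
  <= (2 * (n%:R - 1) + alpha * (alpha + 1))
     / ((alpha + n%:R) * (n%:R + alpha + 1)).
Proof.
move=> n0 alpha0 K1 K2_ge0; set N : R := n%:R.
have N1 : 1 <= N by rewrite /N ler1n.
have N0 : N != 0 by rewrite gt_eqF//; lra.
rewrite [alpha + N]addrC; set A := N + alpha; set D := A * (A + 1).
have A0 : 0 < A by rewrite /A; lra.
have D0 : 0 < D by rewrite mulr_gt0//; lra.
set K2 := \sum_i \sum_j K i j in K2_ge0.
pose tr := \sum_(i < n) K i i.
have trN : tr <= N.
  rewrite /tr /N -[n in n%:R]card_ord -sumr_const; apply: ler_sum => i _.
  by rewrite (le_trans (ler_norm _)).
have K2N : K2 <= N ^+ 2.
  apply: (@le_trans _ _ (\sum_(i < n) \sum_(j < n) 1)).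
    by apply: ler_sum => i _; apply: ler_sum => j _; rewrite (le_trans (ler_norm _)).
  by rewrite !sumr_const card_ord -mulrnA natrM expr2.
have -> : \sum_(i < n) \sum_(j < n) (((1 + (i == j)%:R) / D - 2 * N^-1 / A + N^-1 ^+ 2) * K i j)
    = (tr + (alpha * (alpha + 1) - N) / N ^+ 2 * K2) / D.
  transitivity (tr / D + (D^-1 - 2 * N^-1 / A + N^-1 ^+ 2) * K2); last first.
    by rewrite /D /A; field; rewrite N0 !gt_eqF//; rewrite /A in A0; lra.
  rewrite mulr_suml mulr_sumr -big_split /=; apply: eq_bigr => i _.
  rewrite mulr_sumr (bigD1 i)//= [in RHS](bigD1 i)//= eqxx mulr1n addrA; congr (_ + _); first by ring.
  by apply: eq_bigr => j ji; rewrite eq_sym (negbTE ji) mulr0n; ring.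
rewrite ler_pM2r ?invr_gt0//.
have b0 : 0 < alpha * (alpha + 1) by rewrite mulr_gt0//; lra.
have [bN|bN] := leP N (alpha * (alpha + 1)).
  have : (alpha * (alpha + 1) - N) / N ^+ 2 * K2 <= alpha * (alpha + 1) - N.
    rewrite mulrAC ler_pdivrMr ?exprn_gt0//; last lra.
    by rewrite ler_wpM2l//; lra.
  lra.
(* For [n = 1] the estimate tr <= N is too weak, as 2 (N - 1) = 0; but then tr = K2 and the
   numerator is b K2 <= b. *)
have [n1|n1] := leqP n 1.
  have nE : n = 1%N by apply/eqP; rewrite eqn_leq n1.
  have NE : N = 1 by rewrite /N nE.
  have trE : tr = K2.
    rewrite /tr /K2; apply: eq_bigr => i _; rewrite (bigD1 i)//= big1 ?addr0// => j.
    by case/eqP; apply/val_inj; case: i j => i hi [j hj] /=; move: hi hj; rewrite nE !ltnS !leqn0 => /eqP -> /eqP ->.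
  rewrite trE NE expr1n divr1; move: K2N; rewrite NE expr1n => K21; nra.
have N2 : 2 <= N by rewrite /N (ler_nat _ 2).
have : (alpha * (alpha + 1) - N) / N ^+ 2 * K2 <= 0.
  rewrite mulrAC pmulr_lle0 ?invr_gt0 ?exprn_gt0//; last lra.
  have h : alpha * (alpha + 1) - N <= 0 by lra.
  exact: mulr_le0_ge0.
lra.
Qed.

Lemma weight_bound_gt0 (N alpha : R) : 1 <= N -> 0 < alpha ->
  0 < (2 * (N - 1) + alpha * (alpha + 1)) / ((alpha + N) * (N + alpha + 1)).
Proof.
move=> N1 alpha0; have aa : 0 < alpha * (alpha + 1) by rewrite mulr_gt0//; lra.
by apply: divr_gt0; [|apply: mulr_gt0]; lra.
Qed.

(** A mean is at most the root of the second moment, here for a Beta(alpha, N) variable: the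
    difference between the radicand and the squared mean is its variance. *)
Lemma rest_mean_bound (N alpha : R) : 0 < N -> 0 < alpha ->
  1 - N / (N + alpha)
  <= Num.sqrt ((alpha * (1 + alpha)) / ((alpha + N) * (alpha + N + 1))).
Proof.
move=> N0 alpha0; have A0 : 0 < alpha + N by lra.
have -> : 1 - N / (N + alpha) = alpha / (alpha + N).
  by rewrite [N + alpha]addrC; field; rewrite gt_eqF.
rewrite -[leLHS]ger0_norm; last by rewrite divr_ge0 ?ltW.
rewrite -sqrtr_sqr; apply: ler_wsqrtr.
have -> : alpha * (1 + alpha) / ((alpha + N) * (alpha + N + 1))
   = (alpha / (alpha + N)) ^+ 2
     + alpha * N / ((alpha + N) ^+ 2 * (alpha + N + 1)).
  by field; rewrite !gt_eqF//; lra.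
rewrite lerDl divr_ge0 ?mulr_ge0 ?exprn_ge0//; lra.
Qed.

(** Completing the square. When [s ^+ 2] bounds the mean of [x], the right-hand side has mean at
    most [2 * s]. *)
Lemma sqrt_le_linear (x s : R) : 0 < s -> 0 <= x -> 2 * Num.sqrt x <= x / s + s.
Proof.
move=> s0 x0; rewrite -{2}(sqr_sqrtr x0); set y := Num.sqrt x.
rewrite -subr_ge0 (_ : _ - _ = (y - s) ^+ 2 / s); last by field; rewrite gt_eqF.
by rewrite divr_ge0 ?sqr_ge0 ?ltW.
Qed.

End PosteriorBound.

Section PosteriorStage.
Context (d : measure_display) (X : measurableType d) (R : realType).
Variables (k : X -> X -> R).
Hypothesis mk : measurable_fun setT (fun p : X * X => k p.1 p.2).
Hypothesis k1 : forall x y, `|k x y| <= 1.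
Hypothesis kk : rkernel k.
Variables (Theta : Type) (Ptheta : Theta -> probability X R).
Variable thetastar : {measure set X -> \bar R} -> Theta.
Hypothesis hthetastar : forall P : {measure set X -> \bar R}, P setT = 1%E ->
  forall th, mmd2 k P (Ptheta (thetastar P)) <= mmd2 k P (Ptheta th).
Variables (n T : nat) (alpha : R).
Hypotheses (n0 : (0 < n)%N) (alpha0 : 0 < alpha) (T0 : (0 < T)%N).
Variables (P0 : probability X R) (th : Theta).

Lemma sum_zip_weights (ws : seq R) (zs : seq X) : size ws = size zs ->
  \sum_(q <- zip ws zs) `|q.1| = \sum_(w <- ws) `|w|.
Proof.
move=> sz; rewrite -(big_map fst xpredT (fun w => `|w|)) -/(unzip1 _).
by rewrite unzip1_zip// sz.
Qed.

Lemma empirical_setT (xs : seq X) : size xs = n ->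
  dmeasure (zip (nseq (size xs) (n%:R^-1 : R)) xs) setT = 1%E.
Proof.
move=> sx; rewrite dmeasure_setT sum_zip_weights ?size_nseq// sx big_nseq iter_addr_0.
rewrite ger0_norm ?invr_ge0//; congr EFin.
by rewrite -[LHS]mulr_natl divff// pnatr_eq0 -lt0n.
Qed.

Lemma quad_zip_shift (ws : seq R) (xs : seq X) (c : R) (x0 : X) : size ws = size xs ->
  quad k (zip [seq w - c | w <- ws] xs) =
  \sum_(i < size xs) \sum_(j < size xs)
    (nth 0 ws i - c) * (nth 0 ws j - c) * k (nth x0 xs i) (nth x0 xs j).
Proof.
move=> sz; rewrite (quad_sum kk).
have E (F : R * X -> R) : \sum_(p <- zip [seq w - c | w <- ws] xs) F p
    = \sum_(i < size xs) F (nth 0 ws i - c, nth x0 xs i).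
  rewrite (big_nth (0, x0)) big_mkord size_zip size_map sz minnn.
  apply: eq_bigr => i _; rewrite nth_zip ?size_map//.
  by rewrite (nth_map 0)// sz.
by rewrite E; apply: eq_bigr => i _; rewrite E.
Qed.

(** The bound does not depend on [xt], so averaging it over the pseudo-samples afterwards leaves it
    unchanged. *)
Lemma dirichlet_stage (xs xt : seq X) : size xs = n -> size xt = T ->
  (dirichlet_expect (nseq (size xs) 1 ++ nseq T (alpha / T%:R))%R
     (fun w => (mmd k P0 (Ptheta (thetastar (dmeasure (zip w (xs ++ xt))))))%:E)
   <= (mmd k P0 (Ptheta th)
       + 2 * mmd k P0 (dmeasure (zip (nseq (size xs) n%:R^-1) xs))
       + 2 * Num.sqrt ((2 * (n%:R - 1) + alpha * (alpha + 1))
                       / ((alpha + n%:R) * (n%:R + alpha + 1)))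
       + 2 * Num.sqrt ((alpha * (1 + alpha))
                       / ((alpha + n%:R) * (alpha + n%:R + 1))))%:E)%E.
Proof.
move=> sx st; rewrite /dirichlet_expect.
set a := alpha / T%:R; set C := mmd k P0 (Ptheta th) + _.
set B := (2 * (n%:R - 1) + _) / _; set B' := (alpha * (1 + alpha)) / _.
have C0 : 0 <= C by rewrite addr_ge0 ?mulr_ge0 ?sqrtr_ge0.
(* [gammaF a = 0] is the junk value of a divergent integral; every density then
   vanishes, so convergence of the Gamma integral need not be proved. *)
have [a0|a0] := eqVneq (gammaF a) 0.
  rewrite (gamma_expect_degenerate _ _ a0); last first.
    by rewrite mem_cat !mem_nseq T0 eqxx orbT.
  by rewrite lee_fin !addr_ge0 ?mulr_ge0 ?sqrtr_ge0.
have N1 : (1 : R) <= n%:R by rewrite ler1n.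
have B0 : 0 < B by exact: weight_bound_gt0.
have s0 : 0 < Num.sqrt B by rewrite sqrtr_gt0.
(* Nonempty data supply the default point for [nth]. *)
have [x0 _] : exists x0 : X, true by case: (xs) sx n0 => [<-//|x xs' _ _]; exists x.
pose K (i j : 'I_n) := k (nth x0 xs i) (nth x0 xs j).
pose w (g : seq R) i := nth 0 g i / \sum_(x <- g) x.
pose Q (g : seq R) := \sum_(i < n) \sum_(j < n) (w g i - n%:R^-1) * (w g j - n%:R^-1) * K i j.
have h := @dirichlet_params_nondegenerate R n T alpha a0.
have mQ := dirichlet_quad_mean alpha0 T0 a0 K n%:R^-1.
have mW := dirichlet_rest_mean n alpha0 T0 a0.
(* The mean of the dominating function: a constant, the quadratic form linearised at [Num.sqrt B],
   and twice the weight of the pseudo-samples. *)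
have mtot := gamma_meanD h (gamma_meanD h (gamma_mean_cst (C + Num.sqrt B) h)
  (gamma_meanZ (Num.sqrt B)^-1 h mQ)) (gamma_meanZ 2 h mW).
rewrite sx; apply: (@le_trans _ _ (gamma_expect (nseq n 1 ++ nseq T a)
   (fun g => (C + Num.sqrt B + (Num.sqrt B)^-1 * Q g + 2 * (1 - \sum_(i < n) w g i))%:E))).
  apply: le_gamma_expect => g sg g0; rewrite !lee_fin sqrtr_ge0 /=.
  have S0 := sum_pos_gt0 T0 sg g0.
  have sg' : size g = (n + T)%N by rewrite sg size_dirichlet_params.
  set S := \sum_(h <- g) h in S0.
  pose ws := [seq gi / S | gi <- g].
  have sws : size ws = (n + T)%N by rewrite size_map.
  have ws0 v : v \in ws -> 0 <= v.
    by move=> /mapP[x xg ->]; rewrite divr_ge0 ?ltW// g0.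
  have ws1 : \sum_(v <- ws) v = 1.
    by rewrite big_map -mulr_suml divff// gt_eqF.
  rewrite -/ws -(cat_take_drop n ws).
  have stk : size (take n ws) = size xs by rewrite size_takel ?sx// sws leq_addr.
  have sdr : size (drop n ws) = size xt by rewrite size_drop sws addKn.
  have wsE i : (i < n)%N -> nth 0 (take n ws) i = w g i.
    by move=> iN; rewrite nth_take// (nth_map 0)// sg' ltn_addr.
  have m1 : dmeasure (zip (take n ws ++ drop n ws) (xs ++ xt)) setT = 1%E.
    rewrite dmeasure_setT sum_zip_weights ?size_cat ?stk ?sdr// cat_take_drop.
    by rewrite -ws1; congr EFin; rewrite !big_seq; apply: eq_bigr => v vs; rewrite ger0_norm ?ws0.
  apply: (le_trans (mmd_minimiser_le mk k1 kk hthetastar P0 th m1 (empirical_setT sx))).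
  rewrite -sx -/C -!addrA lerD2l sx.
  have w0 v : v \in take n ws ++ drop n ws -> 0 <= v by rewrite cat_take_drop; exact: ws0.
  have c0 : 0 <= n%:R^-1 :> R by rewrite invr_ge0.
  have := mmd_dmeasure_shift mk k1 kk stk c0 w0 sdr.
  rewrite sx (quad_zip_shift _ x0 stk) sx.
  have -> : \sum_(i < n) \sum_(j < n) (nth 0 (take n ws) i - n%:R^-1)
      * (nth 0 (take n ws) j - n%:R^-1) * k (nth x0 xs i) (nth x0 xs j) = Q g.
    by apply: eq_bigr => i _; apply: eq_bigr => j _; rewrite !wsE.
  have -> : \sum_(v <- drop n ws) v = 1 - \sum_(i < n) w g i.
    rewrite -[X in X - _]ws1 -[in RHS](cat_take_drop n ws) big_cat /=.
    rewrite [X in X + _ - _](_ : _ = \sum_(i < n) w g i); first by rewrite addrC addKr.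
    by rewrite (big_nth 0) big_mkord stk sx; apply: eq_bigr => i _; exact: wsE.
  have Q0 : 0 <= Q g.
    have := quad_ge0 kk (zip [seq v - n%:R^-1 | v <- take n ws] xs).
    rewrite (quad_zip_shift _ x0 stk) sx; congr (_ <= _).
    by apply: eq_bigr => i _; apply: eq_bigr => j _; rewrite !wsE.
  have := sqrt_le_linear s0 Q0; rewrite [_ / Num.sqrt B]mulrC.
  by clear => h1 h2; lra.
rewrite (gamma_mean_expect mtot) lee_fin.
have K2 : 0 <= \sum_i \sum_j K i j.
  have := kk.2 n (fun=> 1) (fun i => nth x0 xs i); congr (_ <= _).
  by apply: eq_bigr => i _; apply: eq_bigr => j _; rewrite !mul1r.
have hB := weight_covariance_bound n0 alpha0 (fun i j => k1 _ _) K2.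
have hB' : 1 - n%:R / (n%:R + alpha) <= Num.sqrt B'.
  by apply: rest_mean_bound => //; lra.
rewrite -/B in hB.
(* Here [q] is the mean of [Q]. From [q <= B] the linearised term has mean at most [Num.sqrt B],
   which with the constant [Num.sqrt B] makes the factor 2. *)
set q := (X in (Num.sqrt B)^-1 * X); have qB : q <= B by exact: hB.
have : (Num.sqrt B)^-1 * q <= Num.sqrt B.
  rewrite mulrC ler_pdivrMr// -expr2 sqr_sqrtr//; exact: ltW.
lra.
Qed.

End PosteriorStage.

(** * Averaging over the data *)

Section DataStage.
Context (d : measure_display) (X : measurableType d) (R : realType).
Implicit Types P Q : probability X R.

Lemma le_mix_expect (Ps : seq (probability X R)) (F G : seq X -> \bar R) :
  (forall s, size s = size Ps -> 0 <= F s <= G s)%E ->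
  (mix_expect Ps F <= mix_expect Ps G)%E.
Proof.
elim: Ps F G => [|P Ps IH] F G FG /=; first by have /andP[] := FG [::] erefl.
apply: ge0_le_integral_nonmeas => y _; apply/andP; split.
  apply: mix_expect_ge0 => s ss.
  by have /andP[] : (0 <= F (y :: s) <= G (y :: s))%E by apply: FG; rewrite /= ss.
by apply: IH => s ss; apply: FG; rewrite /= ss.
Qed.

Lemma mix_expect_cst (Ps : seq (probability X R)) (c : R) :
  mix_expect Ps (fun=> c%:E) = c%:E.
Proof.
elim: Ps => [//|P Ps IH] /=; rewrite IH integral_cst//.
by rewrite [X in (_ * X)%E](@probability_setT _ _ _ P) mule1.
Qed.

Variables (k : X -> X -> R).
Hypothesis mk : measurable_fun setT (fun p : X * X => k p.1 p.2).
Hypothesis k1 : forall x y, `|k x y| <= 1.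
Hypothesis kk : rkernel k.

(** The mean of [mmd2] is (kdiag - kint) / n, hence at most 1 / n. The factor [Num.sqrt n%:R] is the
    slope in [sqrt_le_linear] at s = 1 / sqrt n. *)
Lemma empirical_mmd_mean (P0 : probability X R) (n : nat) (c : R) : (0 < n)%N ->
  (mix_expect (nseq n P0) (fun xs => (c + Num.sqrt n%:R
      * mmd2 k P0 (dmeasure (zip (nseq (size xs) n%:R^-1) xs)))%:E)
   <= (c + (Num.sqrt n%:R)^-1)%:E)%E.
Proof.
move=> n0; set N : R := n%:R; set r := Num.sqrt N.
have N0 : 0 < N by rewrite ltr0n.
have Nn0 : N != 0 by rewrite gt_eqF.
pose m x := \int[P0]_y k y x.
have mE x : m x = \int[P0]_y k x y by apply: eq_Rintegral => y _; rewrite kk.1.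
have bm : bmeas m.
  by rewrite (_ : m = fun x => \int[P0]_y k x y); [exact: bmeas_mean|exact/funext].
have intm : \int[P0]_x m x = kint k P0 P0.
  by rewrite kintE//; apply: eq_Rintegral => x _; rewrite mE.
pose L : seq (R * probability X R) := nseq n (N^-1, P0).
have := mix_expect_quad mk k1 L (c + r * kint k P0 P0) r (bmeasZ (r * -2) bm).
have -> : [seq i.2 | i <- L] = nseq n P0 by rewrite map_nseq.
have -> : [seq i.1 | i <- L] = nseq n N^-1 by rewrite map_nseq.
move=> E.
rewrite (@eq_mix_expect _ _ _ _ _ (fun s => (c + r * kint k P0 P0
    + \sum_(q <- zip (nseq n N^-1) s) q.1 * (r * -2 * m q.2)
    + r * quad k (zip (nseq n N^-1) s))%:E)); last first.
  move=> s; rewrite size_nseq => ss; congr EFin; rewrite mmd2_dmeasure//; last first.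
    move=> q; rewrite -/(unzip1 _) unzip1_zip ?size_nseq// => /nseqP[-> _].
    by rewrite invr_ge0 ltW.
  rewrite ss !mulrDr !addrA mulr_sumr; congr (_ + _ + _).
  by apply: eq_bigr => q _; rewrite /m; ring.
rewrite E lee_fin big_nseq iter_addr_0 prob_intZ// intm -[L]cats0 mean_quad_nseq big_nil /=.
rewrite mulr0 !addr0 -[X in _ + X + _]mulr_natl -/N.
(* The linear part gives -2 [kint] and the quadratic part [kint] + ([kdiag] - [kint]) / N, so the
   multiples of [kint] of order one cancel. *)
have -> : c + r * kint k P0 P0 + N * (N^-1 * (r * -2 * kint k P0 P0))
  + r * (N * N^-1 ^+ 2 * kdiag k P0 + N * (N - 1) * N^-1 ^+ 2 * kint k P0 P0)
  = c + (kdiag k P0 - kint k P0 P0) * (r / N) by field.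
have rr : r ^+ 2 = N by rewrite sqr_sqrtr// ltW.
have rN : r / N = r^-1.
  by rewrite -[in LHS]rr; field; rewrite gt_eqF// sqrtr_gt0.
rewrite rN lerD2l ger_pMl ?invr_gt0 ?sqrtr_gt0//.
have := kdiag_norm mk k1 P0; have := kint_ge0 mk k1 kk P0.
by rewrite ler_norml; clear => h1 /andP[_ h2]; lra.
Qed.

End DataStage.

(** * Combining the averages over weights, pseudo-samples and data *)

Theorem theorem1 (d : measure_display) (X : measurableType d) (R : realType)
    (k : X -> X -> R)
    (hk_meas : measurable_fun setT (fun p : X * X => k p.1 p.2))
    (hk_kern : rkernel k)
    (hk_bnd : forall x y, `|k x y| <= 1)
    (Theta : Type) (Ptheta : Theta -> probability X R)
    (thetastar : {measure set X -> \bar R} -> Theta)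
    (hthetastar : forall P : {measure set X -> \bar R}, P setT = 1%E ->
       forall th, mmd2 k P (Ptheta (thetastar P)) <= mmd2 k P (Ptheta th))
    (P0 : probability X R) (n : nat) (hn : (1 <= n)%N)
    (alpha : R) (halpha : 0 < alpha) (T : nat) (hT : (1 <= T)%N)
    (Fm : probability X R) :
  (iid_expect P0 n (fun xs =>
     nu_expect alpha T Fm xs (fun P => (mmd k P0 (Ptheta (thetastar P)))%:E))
   <= ereal_inf [set (mmd k P0 (Ptheta th))%:E | th in [set: Theta]]
      + (2 / Num.sqrt n%:R
         + 2 * Num.sqrt ((2 * (n%:R - 1) + alpha * (alpha + 1))
                         / ((alpha + n%:R) * (n%:R + alpha + 1)))
         + 2 * Num.sqrt ((alpha * (1 + alpha))
                         / ((alpha + n%:R) * (alpha + n%:R + 1))))%:E)%E.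
Proof.
rewrite -leeBlDr//; apply: le_ereal_inf_tmp => _ [th _ <-]; rewrite leeBlDr// -EFinD.
set S1 := Num.sqrt ((2 * _ + _) / _); set S2 := Num.sqrt (_ * (1 + _) / _).
set r := Num.sqrt n%:R; have r0 : 0 < r by rewrite sqrtr_gt0 ltr0n.
(* Half of [2 / r] is kept in [c], as the constant from linearising the empirical distance; the
   other half is the mean of the [mmd2] term. *)
pose c := mmd k P0 (Ptheta th) + r^-1 + 2 * S1 + 2 * S2.
have -> : mmd k P0 (Ptheta th) + (2 / r + 2 * S1 + 2 * S2) = c + r^-1.
  by rewrite /c; ring.
apply: le_trans (empirical_mmd_mean hk_meas hk_bnd hk_kern P0 c hn).
rewrite iid_expectE; apply: le_mix_expect => xs; rewrite size_nseq => sx.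
rewrite /nu_expect iid_expectE; apply/andP; split.
  apply: mix_expect_ge0 => xt _; apply: gamma_expect_ge0 => g _ _.
  by rewrite lee_fin sqrtr_ge0.
rewrite -[leRHS](mix_expect_cst (nseq T Fm)); apply: le_mix_expect => xt.
rewrite size_nseq => st; apply/andP; split.
  by apply: gamma_expect_ge0 => g _ _; rewrite lee_fin sqrtr_ge0.
apply: le_trans (dirichlet_stage hk_meas hk_bnd hk_kern hthetastar hn halpha hT P0 th sx st) _.
rewrite lee_fin -/S1 -/S2 /c.
have [E EE] := measure_probability (empirical_setT R hn sx).
have q0 : 0 <= mmd2 k P0 (dmeasure (zip (nseq (size xs) n%:R^-1) xs)).
  by rewrite -EE; exact: mmd2_ge0.
(* At s = [r^-1], twice the distance from [P0] to the empirical measure is at most [r] times its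
   square plus [r^-1]. *)
have := @sqrt_le_linear _ _ r^-1 _ q0; rewrite invr_gt0 invrK => /(_ r0).
rewrite -/(mmd _ _ _) [_ * r]mulrC -/r.
by move: (mmd k P0 (Ptheta th)) (mmd _ _ _) (mmd2 _ _ _) => x y z; lra.
Qed.
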